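(* Let $V$ be a finite-dimensional irreducible $gl(n)$-module with highest weight $\mu$, and consider the $sl(n+1)$-module $\mathcal{A}\otimes_{\mathbb{F}}V$ (the generalized projective representation). (i) The space $\mathcal{A}\otimes_{\mathbb{F}}V$ is an irreducible $sl(n+1)$-module if and only if $$\mu(E_{1,1})+\sum_{j=1}^{n}\mu(E_{j,j})\notin -\mathbb{N}\,\cup\,\overline{2,\,1+\mu(E_{1,1}-E_{2,2})}$$ and $$\mu(E_{i,i})+\sum_{j=1}^{n}\mu(E_{j,j})-i\notin \overline{1,\,\mu(E_{i,i}-E_{i+1,i+1})}\qquad\text{for all } i\in\overline{2,n-1}.$$ (ii) If one of the conditions displayed in (i) fails, then both $U(sl(n+1))(1\otimes V)$ and $(\mathcal{A}\otimes_{\mathbb{F}}V)/\big(U(sl(n+1))(1\otimes V)\big)$ are irreducible $sl(n+1)$-modules.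
   Context: $\mathbb{F}$ is a field of characteristic $0$, $n\ge 2$ is an integer, and $\mathbb{N}=\{0,1,2,\dots\}$. For integers $a,b$, $\overline{a,b}=\{a,a+1,\dots,b\}$ if $a\le b$ and $\overline{a,b}=\emptyset$ otherwise. $gl(n)$ is the Lie algebra of $n\times n$ matrices over $\mathbb{F}$ with matrix units $E_{i,j}$. A highest weight $\mu$ of an irreducible $gl(n)$-module $V$ is a linear function on $\sum_i\mathbb{F}E_{i,i}$ such that there is a nonzero $v\in V$ with $E_{i,i}v=\mu(E_{i,i})v$ for all $i$ and $E_{i,j}v=0$ for $i<j$; for finite-dimensional $V$ all $\mu(E_{i,i}-E_{i+1,i+1})$ are in $\mathbb{N}$. $\mathcal{A}=\mathbb{F}[x_1,\dots,x_n]$. Let $p_i=x_i\sum_{r=1}^n x_r\partial_{x_r}$. The span of $\{\partial_{x_j},\,x_i\partial_{x_j},\,p_i\mid i,j\in\overline{1,n}\}$ is a Lie algebra of derivations of $\mathcal{A}$ isomorphic to $sl(n+1)$, and $sl(n+1)$ is identified with it; the Chevalley generators are $h_i=x_i\partial_{x_i}-x_{i+1}\partial_{x_{i+1}}$, $e_i=x_i\partial_{x_{i+1}}$, $f_i=x_{i+1}\partial_{x_i}$ for $i\in\overline{1,n-1}$, and $h_n=\sum_{i=1}^nx_i\partial_{x_i}+x_n\partial_{x_n}$, $e_n=p_n$, $f_n=-\partial_{x_n}$. The generalized projective representation is the $sl(n+1)$-module $\mathcal{A}\otimes_{\mathbb{F}}V$ with action, for $f\in\mathcal{A}$, $v\in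 V$, $$(x_i\partial_{x_j}).(f\otimes v)=x_i\partial_{x_j}(f)\otimes v+f\otimes E_{i,j}v,\qquad \partial_{x_i}.(f\otimes v)=\partial_{x_i}(f)\otimes v,$$ $$p_i.(f\otimes v)=p_i(f)\otimes v+x_if\otimes\sum_{r=1}^nE_{r,r}v+\sum_{j=1}^nx_jf\otimes E_{i,j}v.$$ (This is the restriction of the action $\pi(\sum_i a_i\partial_{x_i})=\sum_{i,j}\partial_{x_i}(a_j)\otimes E_{i,j}+\sum_i a_i\partial_{x_i}\otimes\mathrm{Id}_V$ of the Witt algebra.) $U(\cdot)$ denotes the universal enveloping algebra. *)

(* Defs.v *)
From HB Require Import structures.
From mathcomp Require Import all_boot all_order all_algebra.
From mathcomp Require Import boolp.
From mathcomp Require Import mpoly.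

Set Implicit Arguments.
Unset Strict Implicit.
Unset Printing Implicit Defensive.

Import GRing.Theory.
Local Open Scope ring_scope.
Local Open Scope quotient_scope.

Fact linear_sub (R : pzRingType) (M W : lmodType R) (f : M -> W) :
  linear f -> {morph f : u v / u - v}.
Proof. by move=> lin u v; rewrite addrC -scaleN1r lin scaleN1r addrC. Qed.

Fact linear_zero (R : pzRingType) (M W : lmodType R) (f : M -> W) :
  linear f -> f 0 = 0.
Proof. by move=> lin; rewrite -(subrr 0) linear_sub // subrr. Qed.

(* [g] is a Lie algebra given by a predicate on an ambient vector space [L],
   acting on [M] through [act]; only the values of [act] on [g] matter. *)
Section LieModules.
Variables (F : fieldType) (L : lmodType F) (g : L -> Prop).
Variables (M : lmodType F) (act : L -> M -> M).

Definition lie_submodule (W : {pred M}) : Prop :=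
  submod_closed W /\ (forall x m, g x -> m \in W -> act x m \in W).

(* The subspace [N] of [M], with the restricted action, is an irreducible
   [g]-module; [N := predT] gives irreducibility of [M] itself. *)
Definition irreducible_module (N : {pred M}) : Prop :=
  [/\ lie_submodule N,
      exists2 m, m \in N & m != 0
    & forall W : {pred M}, lie_submodule W -> {subset W <= N} ->
        (forall m, m \in W -> m = 0) \/ {subset N <= W}].

(* U(g) is linearly spanned by the products x_1 ... x_k of elements of g, and
   such a product acts on m as x_1.(x_2. ... (x_k.m)). *)
Definition Uspan (S : M -> Prop) : {pred M} := [pred m | `[<
  exists (r : nat) (c : 'I_r -> F) (w : 'I_r -> seq L) (s : 'I_r -> M),
    [/\ forall i x, x \in w i -> g x,
        forall i, S (s i)
      & m = \sum_(i < r) c i *: foldr act (s i) (w i)] >]].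

Lemma Uspan_submod_closed (S : M -> Prop) : submod_closed (Uspan S).
Proof.
split=> [|a u v /asboolP[r1 [c1 [w1 [s1 [g1 S1 ->]]]]]
                /asboolP[r2 [c2 [w2 [s2 [g2 S2 ->]]]]]]; apply/asboolP.
  exists 0%N, (fun=> 0), (fun=> [::]), (fun=> 0).
  by split=> [[]|[]|] //; rewrite big_ord0.
pose glue T (f1 : 'I_r1 -> T) f2 (i : 'I_(r1 + r2)) :=
  match fintype.split i with inl j => f1 j | inr k => f2 k end.
exists (r1 + r2)%N, (glue _ (fun j => a * c1 j) c2), (glue _ w1 w2),
  (glue _ s1 s2); split.
- by move=> i x; rewrite /glue; case: fintype.split => j; [apply: g1|apply: g2].
- by move=> i; rewrite /glue; case: fintype.split.
rewrite big_split_ord /= scaler_sumr; congr (_ + _); apply: eq_bigr => i _.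
  by rewrite /glue -/(unsplit (inl i)) unsplitK scalerA.
by rewrite /glue -/(unsplit (inr i)) unsplitK.
Qed.

End LieModules.

Section QuotientModule.
Variables (F : fieldType) (M : lmodType F).
Variables (N : {pred M}) (N_closed : submod_closed N).

Definition closed_pred of submod_closed N : {pred M} := N.

HB.instance Definition _ :=
  GRing.isSubmodClosed.Build F M (closed_pred N_closed) N_closed.

(* The quotient space M / N. *)
Definition quot_module := Quotient.quot (closed_pred N_closed).
HB.instance Definition _ := GRing.Zmodule.on quot_module.

Definition quot_proj (m : M) : quot_module :=
  \pi_(Quotient.quot (closed_pred N_closed)) m.
Definition quot_repr (q : quot_module) : M := repr q.
Definition quot_scale (a : F) (q : quot_module) : quot_module :=
  quot_proj (a *: quot_repr q).

Lemma quot_eqP (m m' : M) : reflect (quot_proj m = quot_proj m') (m - m' \in N).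
Proof.
rewrite -[_ \in N]/(_ \in closed_pred N_closed) Quotient.idealrBE.
exact: eqP.
Qed.

Lemma quot_reprK : cancel quot_repr quot_proj.
Proof. by move=> q; apply: reprK. Qed.

Lemma quot_projD : {morph quot_proj : m m' / m + m'}.
Proof. by move=> m m'; apply: raddfD. Qed.

Lemma quot_scaleE (a : F) (m : M) : quot_scale a (quot_proj m) = quot_proj (a *: m).
Proof.
apply/quot_eqP; rewrite -scalerBr.
by apply: (rpredZ (s := closed_pred N_closed)); apply/quot_eqP/quot_reprK.
Qed.

Fact quot_scaleA a b q : quot_scale a (quot_scale b q) = quot_scale (a * b) q.
Proof. by rewrite -[q]quot_reprK !quot_scaleE scalerA. Qed.

Fact quot_scale1 : left_id 1 quot_scale.
Proof. by move=> q; rewrite -[q]quot_reprK quot_scaleE scale1r. Qed.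

Fact quot_scaleDr : right_distributive quot_scale +%R.
Proof.
move=> a q r; rewrite -[q]quot_reprK -[r]quot_reprK -quot_projD !quot_scaleE.
by rewrite scalerDr quot_projD.
Qed.

Fact quot_scaleDl q : {morph quot_scale^~ q : a b / a + b}.
Proof.
by move=> a b; rewrite /= -[q]quot_reprK !quot_scaleE scalerDl quot_projD.
Qed.

HB.instance Definition _ := GRing.Zmodule_isLmodule.Build F quot_module
  quot_scaleA quot_scale1 quot_scaleDr quot_scaleDl.

Variables (L : lmodType F) (g : L -> Prop) (act : L -> M -> M).

(* The induced action on M / N; see [quot_actE]. *)
Definition quot_act (x : L) (q : quot_module) : quot_module :=
  quot_proj (act x (quot_repr q)).

Lemma quot_actE (x : L) (m : M) :
    g x -> (forall a, linear (act a)) -> lie_submodule g act N ->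
  quot_act x (quot_proj m) = quot_proj (act x m).
Proof.
move=> gx lin [_ stabN]; apply/quot_eqP.
rewrite -(linear_sub (lin x)).
by apply: stabN => //; apply/quot_eqP/quot_reprK.
Qed.

End QuotientModule.

Section GlModules.
Variables (F : fieldType) (n : nat) (V : vectType F).
Variable rho : {linear 'M[F]_n -> 'End(V)}.

Definition gl_representation : Prop := forall (A B : 'M[F]_n) (v : V),
  rho (A *m B - B *m A) v = rho A (rho B v) - rho B (rho A v).

Definition gl_irreducible : Prop :=
  irreducible_module (fun=> True) (fun A : 'M[F]_n => rho A : V -> V) predT.

(* The linear function [mu] on the diagonal matrices is given by its values
   mu i = mu(E_{i,i}) on their basis. *)
Definition highest_weight (mu : 'I_n -> F) : Prop := exists v : V,
  [/\ v != 0,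
      forall i, rho (delta_mx i i) v = mu i *: v
    & forall i j : 'I_n, (i < j)%N -> rho (delta_mx i j) v = 0].

End GlModules.

(* A vector field \sum_i a_i d/dx_i is encoded by its coefficients a_i. *)
Notation vector_field F n := {ffun 'I_n -> {mpoly F[n]}}.

Section VectorFields.
Variables (F : fieldType) (n : nat).
Local Notation A := {mpoly F[n]}.

Fact mderiv_var (i j : 'I_n) : mderiv i ('X_j : A) = (j == i)%:R.
Proof.
rewrite mderivX mnm1E; case: eqP => [->|_]; last by rewrite scale0r.
by rewrite scale1r -[X in mnm_sub X _]add0m addmK mpolyX0.
Qed.

Definition derivation (a : vector_field F n) (f : A) : A :=
  \sum_i a i * mderiv i f.

Definition vf_partial (j : 'I_n) : vector_field F n :=
  [ffun k => if k == j then 1 else 0].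
Definition vf_xpartial (i j : 'I_n) : vector_field F n :=
  [ffun k => if k == j then 'X_i else 0].
Definition vf_p (i : 'I_n) : vector_field F n := [ffun k => 'X_i * 'X_k].

Lemma derivation_partial j f : derivation (vf_partial j) f = mderiv j f.
Proof.
rewrite /derivation (bigD1 j) //= ffunE eqxx mul1r big1 ?addr0 // => i ne_ij.
by rewrite ffunE (negPf ne_ij) mul0r.
Qed.

Lemma derivation_xpartial i j f :
  derivation (vf_xpartial i j) f = 'X_i * mderiv j f.
Proof.
rewrite /derivation (bigD1 j) //= ffunE eqxx big1 ?addr0 // => k ne_kj.
by rewrite ffunE (negPf ne_kj) mul0r.
Qed.

Lemma derivation_p i f :
  derivation (vf_p i) f = 'X_i * \sum_r 'X_r * mderiv r f.
Proof. by rewrite mulr_sumr; apply: eq_bigr => r _; rewrite ffunE mulrA. Qed.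

(* The Lie algebra sl(n+1) of derivations of F[x_1, ..., x_n]. *)
Definition sl_span (a : vector_field F n) : Prop :=
  exists (b : 'I_n -> F) (c : 'I_n -> 'I_n -> F) (d : 'I_n -> F),
    a = \sum_j b j *: vf_partial j + \sum_i \sum_j c i j *: vf_xpartial i j
        + \sum_i d i *: vf_p i.

End VectorFields.

Section PolyTensor.
Variables (F : fieldType) (n : nat) (V : vectType F).
Local Notation A := {mpoly F[n]}.
(* F[x_1, ..., x_n] (x) V, through the basis e of V: the family (f_k)_k stands
   for \sum_k f_k (x) e_k.  See [poly_tensor_universal]. *)
Local Notation AV := {ffun 'I_(\dim {:V}) -> A}.
Local Notation e k := (vbasis {:V})`_k.

Definition pure_tensor (f : A) (v : V) : AV :=
  [ffun k => coord (vbasis {:V}) k v *: f].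

Lemma pure_tensor_bilinear :
  (forall v, linear (pure_tensor^~ v)) /\ (forall f, linear (pure_tensor f)).
Proof.
split=> [v c f g|f c u v]; apply/ffunP => k; rewrite !ffunE.
  by rewrite scalerDr !scalerA mulrC.
by rewrite linearP scalerDl scalerA.
Qed.

Lemma poly_tensor_sum (m : AV) : m = \sum_k pure_tensor (m k) (e k).
Proof.
apply/ffunP => j; rewrite sum_ffunE (bigD1 j) //= ffunE.
have fr : free (vbasis {:V}) := basis_free (vbasisP _).
rewrite coord_free // eqxx scale1r big1 ?addr0 // => k ne_kj.
by rewrite ffunE coord_free // [_ == _](negPf ne_kj) scale0r.
Qed.

Lemma poly_tensor_universal (W : lmodType F) (B : A -> V -> W) :
    (forall v, linear (B^~ v)) -> (forall f, linear (B f)) ->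
  exists phi : AV -> W,
    [/\ linear phi, forall f v, phi (pure_tensor f v) = B f v
      & forall psi : AV -> W, linear psi ->
          (forall f v, psi (pure_tensor f v) = B f v) -> psi =1 phi].
Proof.
move=> linl linr; pose phi (m : AV) := \sum_k B (m k) (e k).
have Bl c f g v : B (c *: f + g) v = c *: B f v + B g v := linl v c f g.
have B0r f : B f 0 = 0 := linear_zero (linr f).
have B0l v : B 0 v = 0 := linear_zero (linl v).
exists phi; split.
- move=> c m m'; rewrite scaler_sumr -big_split; apply: eq_bigr => k _ /=.
  by rewrite !ffunE Bl.
- move=> f v; rewrite {2}(coord_vbasis (memvf v)) /phi.
  elim/big_rec2: _ => [|k w u _ ->]; first by rewrite B0r.
  by rewrite linr ffunE -[_ *: f]addr0 Bl B0l addr0.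
move=> psi linpsi psiE m; rewrite [in LHS](poly_tensor_sum m) /phi.
have psi0 : psi 0 = 0 := linear_zero linpsi.
elim/big_rec2: _ => [//|k w u _ <-].
by rewrite -[pure_tensor _ _]scale1r linpsi psiE scale1r.
Qed.

(* phi (x) T *)
Definition tensor_map (phi : A -> A) (T : V -> V) (m : AV) : AV :=
  \sum_k pure_tensor (phi (m k)) (T (e k)).

Lemma tensor_mapE (phi : A -> A) (T : V -> V) f v : linear phi -> linear T ->
  tensor_map phi T (pure_tensor f v) = pure_tensor (phi f) (T v).
Proof.
have [ptl ptr] := pure_tensor_bilinear => linphi linT.
have ptl' c g h w : pure_tensor (c *: g + h) w
    = c *: pure_tensor g w + pure_tensor h w := ptl w c g h.
have phi0 := linear_zero linphi; have T0 := linear_zero linT.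
have pt0r g : pure_tensor g 0 = 0 := linear_zero (ptr g).
have pt0l w : pure_tensor 0 w = 0 := linear_zero (ptl w).
rewrite {2}(coord_vbasis (memvf v)) /tensor_map.
elim/big_rec2: _ => [|k w u _ ->]; first by rewrite T0 pt0r.
by rewrite linT ptr ffunE -[_ *: f]addr0 linphi phi0 addr0
           -[_ *: phi f]addr0 ptl' pt0l addr0.
Qed.

Variable rho : {linear 'M[F]_n -> 'End(V)}.

(* \sum_{i,j} d_i(a_j) (x) E_{i,j} + \sum_i a_i d_i (x) Id_V, on all vector
   fields; on generators of sl(n+1), see [vf_act_xpartial], [vf_act_partial]
   and [vf_act_p]. *)
Definition vf_act (a : vector_field F n) (m : AV) : AV :=
  \sum_i \sum_j tensor_map (fun f => mderiv i (a j) * f) (rho (delta_mx i j)) m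
  + tensor_map (derivation a) idfun m.

Lemma derivation_linear (a : vector_field F n) : linear (derivation a).
Proof.
move=> c f g; rewrite /derivation scaler_sumr -big_split; apply: eq_bigr => i _.
by rewrite linearP mulrDr scalerAr.
Qed.

Lemma vf_act_pure a f v : vf_act a (pure_tensor f v) =
  \sum_i \sum_j pure_tensor (mderiv i (a j) * f) (rho (delta_mx i j) v)
  + pure_tensor (derivation a f) v.
Proof.
rewrite /vf_act tensor_mapE //; last exact: derivation_linear.
congr (_ + _); apply: eq_bigr => i _; apply: eq_bigr => j _.
rewrite tensor_mapE // => c g h; last exact: linearP.
by rewrite mulrDr scalerAr.
Qed.

Lemma vf_act_partial j f v :
  vf_act (vf_partial F j) (pure_tensor f v) = pure_tensor (mderiv j f) v.
Proof.
have pt0 w : pure_tensor 0 w = 0 := linear_zero (pure_tensor_bilinear.1 w).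
rewrite vf_act_pure derivation_partial big1 ?add0r // => i _.
apply: big1 => k _; rewrite ffunE -mpolyC1.
by case: eqP => _; rewrite ?mderivC ?mderiv0 mul0r.
Qed.

Lemma vf_act_xpartial i j f v :
  vf_act (vf_xpartial F i j) (pure_tensor f v) =
    pure_tensor ('X_i * mderiv j f) v + pure_tensor f (rho (delta_mx i j) v).
Proof.
have pt0 w : pure_tensor 0 w = 0 := linear_zero (pure_tensor_bilinear.1 w).
rewrite vf_act_pure derivation_xpartial addrC; congr (_ + _).
rewrite (bigD1 i) //= (bigD1 j) //= !big1 => [|r ne_ri|k ne_kj].
- by rewrite !addr0 ffunE eqxx mderiv_var eqxx mul1r.
- apply: big1 => k _; rewrite ffunE; case: eqP => _; last by rewrite mderiv0 mul0r.
  by rewrite mderiv_var eq_sym (negPf ne_ri) mul0r.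
by rewrite ffunE (negPf ne_kj) mderiv0 mul0r.
Qed.

Lemma vf_act_p i f v :
  vf_act (vf_p F i) (pure_tensor f v) =
    pure_tensor ('X_i * \sum_r 'X_r * mderiv r f) v
    + pure_tensor ('X_i * f) (\sum_r rho (delta_mx r r) v)
    + \sum_j pure_tensor ('X_j * f) (rho (delta_mx i j) v).
Proof.
have [ptl ptr] := pure_tensor_bilinear.
have pt0 w : pure_tensor 0 w = 0 := linear_zero (ptl w).
have ptD g h w : pure_tensor (g + h) w = pure_tensor g w + pure_tensor h w.
  by have := ptl w 1 g h; rewrite !scale1r.
have ptDr g u w : pure_tensor g (u + w) = pure_tensor g u + pure_tensor g w.
  by have := ptr g 1 u w; rewrite !scale1r.
rewrite vf_act_pure derivation_p addrC -addrA; congr (_ + _).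
under eq_bigr => r _ do under eq_bigr => j _ do
  rewrite ffunE mderivM !mderiv_var mulrDl ptD.
under eq_bigr do rewrite big_split.
rewrite big_split /= addrC; congr (_ + _).
  transitivity (\sum_r pure_tensor ('X_i * f) (rho (delta_mx r r) v)).
    apply: eq_bigr => r _; rewrite (bigD1 r) //= big1 ?addr0 => [|j ne_jr].
      by rewrite eqxx mulr1.
    by rewrite (negPf ne_jr) mulr0 mul0r.
  elim/big_rec2: _ => [|r u w _ ->]; last by rewrite ptDr.
  exact/esym/(linear_zero (ptr _)).
rewrite (bigD1 i) //= [X in _ + X]big1 ?addr0 => [|r ne_ri].
  by apply: eq_bigr => j _; rewrite eqxx mul1r.
by apply: big1 => j _; rewrite eq_sym (negPf ne_ri) !mul0r.
Qed.

(* 1 (x) V *)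
Definition one_tensor (m : AV) : Prop := exists v, m = pure_tensor 1 v.

End PolyTensor.

Section WeightConditions.
Variable F : fieldType.

Definition neg_nat (x : F) : Prop := exists k : nat, x = - k%:R.

(* x lies in {a, a+1, ..., b}, for integers a and b of F. *)
Definition int_interval (a b x : F) : Prop :=
  exists s t z : int,
    [/\ a = s%:~R, b = t%:~R, x = z%:~R, (s <= z)%R & (z <= t)%R].

Variables (n : nat) (n_ge2 : (1 < n)%N) (mu : 'I_n -> F).

(* mu_1 and mu_2; ordinals are numbered from 0. *)
Local Notation mu1 := (mu (Ordinal (ltnW n_ge2))).
Local Notation mu2 := (mu (Ordinal n_ge2)).

Definition weight_cond_first : Prop :=
  ~ (neg_nat (mu1 + \sum_j mu j)
     \/ int_interval 2 (1 + (mu1 - mu2)) (mu1 + \sum_j mu j)).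

(* The ordinals i and j = i + 1 stand for the indices i + 1 and i + 2 of the
   E_{i,i}, so that i + 1 ranges over {2, ..., n - 1}. *)
Definition weight_cond_inner : Prop :=
  forall i j : 'I_n, (0 < i)%N -> j = i.+1 :> nat ->
    ~ int_interval 1 (mu i - mu j) (mu i + \sum_k mu k - (i.+1)%:R).

End WeightConditions.

(* Main.v *)
From HB Require Import structures.
Require Import Defs.
From mathcomp Require Import all_boot all_order all_algebra.
From mathcomp Require Import boolp.
From mathcomp Require Import mpoly.
From mathcomp Require Import zify ring.
Set Implicit Arguments.
Unset Strict Implicit.
Unset Printing Implicit Defensive.
Import GRing.Theory.
Local Open Scope ring_scope.

(** The module M = A (x) V is graded by the degree of polynomials.  Derivations
    bring a nonzero element down to degree 0, so every nonzero submodule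
    contains 1 (x) V ([nonzero_contains_one]); hence N = U(sl(n+1))(1 (x) V) is
    the unique minimal submodule and it is irreducible.  It remains to decide
    when N is all of M, and to show that nothing lies strictly between N and M.

    Both questions are studied on linear functionals of M, where E_ab acts by
    transposition of E_ba.  Let v be the highest weight vector of V.  As V is
    spanned by vectors lowered from v, a functional that is singular for gl(n)
    is determined by its values at the vectors x^al (x) v ([singular_eq0]).  A
    nonzero singular weight functional psi_al thus has weight mu + al, with
    exponents al in N^n; it is unique up to scalars, and al must be a horizontal
    strip added to mu: al_b <= mu_a - mu_b for a < b ([row_weight_strip]).  The
    rest of the proof moves between strips.
    - Removal.  If j is the last nonempty row of al, then the composite of
      psi_al with p_j is a multiple of psi_(al - eps_j), by the content
      |mu| + mu_j + (al_j - 1) + 1 - j of the removed box, where rows are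
      numbered from 1 and |mu| = \sum_i mu_i ([row_removal]).
    - Insertion.  From psi_al, the derivations and gl(n) produce
      psi_(al + eps_j) for every row j that has room for a box
      ([row_insertion]), by solving a triangular system
      ([exists_row_insertion]).

    Contents in different rows lie in disjoint ranges of integers, so at most
    one box that can occur in a strip has content 0 ([critical_unique]).  If it
    is the K-th box of row j, the pair (j, K) is called critical; the conditions
    of the theorem say that there is no critical pair ([weight_conditions]).

    A functional of least degree that kills a proper submodule containing
    1 (x) V is killed by all the p_i, and this is possible only for
    psi_(K eps_j) with (j, K) critical ([proper_critical]).  Conversely, for a
    critical pair this functional exists and kills N
    ([critical_not_generated]).  Finally let W be a proper submodule containing
    N.  Then psi_(K eps_j) kills W, and by insertion so does every psi_al with
    al_j >= K.  By removal, these are all the singular functionals that kill N.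
    If W were larger than N, some functional would kill N but not W.  Singular
    vectors lift from quotients of finite-dimensional gl(n)-modules, because
    the Casimir operator separates comparable dominant weights
    ([exists_singular_outside]), so this functional could be chosen singular,
    which is a contradiction ([proper_generated]). *)

(** * Subspaces and eigenvectors *)

Section Subspaces.
Variables (F : fieldType) (X : lmodType F).

Definition subspace (Z : X -> Prop) : Prop :=
  Z 0 /\ forall c x y, Z x -> Z y -> Z (c *: x + y).

Variables (Z : X -> Prop) (subZ : subspace Z).

Lemma subspaceD x y : Z x -> Z y -> Z (x + y).
Proof. by move=> Zx Zy; rewrite -[x]scale1r; apply: subZ.2. Qed.

Lemma subspaceZ c x : Z x -> Z (c *: x).
Proof. by move=> Zx; rewrite -[_ *: _]addr0; apply: subZ.2 => //; exact: subZ.1. Qed.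

Lemma subspaceN x : Z x -> Z (- x).
Proof. by move=> Zx; rewrite -scaleN1r; apply: subspaceZ. Qed.

Lemma subspaceB x y : Z x -> Z y -> Z (x - y).
Proof. by move=> Zx Zy; apply: subspaceD => //; apply: subspaceN. Qed.

Lemma subspace_sum (I : Type) (r : seq I) (P : pred I) (G : I -> X) :
  (forall i, P i -> Z (G i)) -> Z (\sum_(i <- r | P i) G i).
Proof. by move=> ZG; elim/big_ind: _ => //; [exact: subZ.1 | exact: subspaceD]. Qed.

End Subspaces.

Section Spectrum.
Variables (F : fieldType) (X : lmodType F) (T : {linear X -> X}).

(** The product of the commuting operators [T - r], for [r] in [rs]. *)
Definition spectral (rs : seq F) (x : X) : X :=
  foldr (fun r y => T y - r *: y) x rs.

Lemma spectral_linear rs c x y :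
  spectral rs (c *: x + y) = c *: spectral rs x + spectral rs y.
Proof.
elim: rs => //= r rs ->; rewrite linearP scalerDr opprD addrACA; congr (_ + _).
by rewrite scalerBr !scalerA mulrC.
Qed.

Lemma spectral_eigen rs r x :
  T x = r *: x -> spectral rs x = \prod_(s <- rs) (r - s) *: x.
Proof.
move=> Tx; elim: rs => [|s rs IH] /=; first by rewrite big_nil scale1r.
by rewrite IH linearZ /= Tx !scalerA -scalerBl big_cons mulrBl [r * _]mulrC.
Qed.

Lemma spectral_stable (Z : X -> Prop) rs x : subspace Z ->
  (forall y, Z y -> Z (T y)) -> Z x -> Z (spectral rs x).
Proof.
move=> subZ TZ Zx; elim: rs => //= r rs Zy.
by apply: subspaceB => //; [exact: TZ | exact: subspaceZ].
Qed.

Lemma eigenvalue_in_spectrum rs r x :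
  spectral rs x = 0 -> T x = r *: x -> x != 0 -> r \in rs.
Proof.
move=> + Tx nzx; rewrite (spectral_eigen _ Tx) => /eqP.
rewrite scaler_eq0 (negPf nzx) orbF => /eqP; elim: rs => [|s rs IH].
  by rewrite big_nil => /eqP; rewrite oner_eq0.
rewrite big_cons in_cons => /eqP; rewrite mulf_eq0 subr_eq0.
by case/orP => [->//|/eqP/IH ->]; rewrite orbT.
Qed.

(** When [T] is killed by a product of distinct linear factors, it is
    diagonalizable, so that an eigenvector can be found outside any given
    subspace: the eigencomponents of [x] cannot all lie in [Z']. *)
Lemma eigenvector_outside (Z Z' : X -> Prop) rs x :
    subspace Z -> (forall y, Z y -> Z (T y)) -> subspace Z' ->
    uniq rs -> Z x -> ~ Z' x -> spectral rs x = 0 ->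
  exists r y, [/\ Z y, ~ Z' y & T y = r *: y].
Proof.
move=> subZ TZ subZ'; elim: rs x => [|r rs IH] x /=.
  by move=> _ _ nZx x0; case: nZx; rewrite x0; exact: subZ'.1.
case/andP=> r_rs uniq_rs Zx nZx /eqP; rewrite subr_eq0 => /eqP Ty.
have Zy : Z (spectral rs x) by apply: spectral_stable.
have [Z'y|nZ'y] := pselect (Z' (spectral rs x)); last first.
  by exists r, (spectral rs x).
pose p := \prod_(s <- rs) (r - s).
have nzp : p != 0.
  rewrite /p; elim: rs r_rs {IH uniq_rs Ty Zy Z'y p} => [|s rs IH].
    by rewrite big_nil oner_eq0.
  rewrite in_cons negb_or big_cons mulf_eq0 subr_eq0 => /andP[/negPf -> ?].
  exact: IH.
apply: (IH (- p^-1 *: spectral rs x + x)) => //.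
- exact: subZ.2.
- move=> Z'x; apply: nZx.
  rewrite -[x](addKr (- p^-1 *: spectral rs x)).
  by apply: subspaceD => //; apply: subspaceN => //; apply: subspaceZ.
rewrite spectral_linear (spectral_eigen _ Ty) scalerA -/p mulNr mulVf //.
by rewrite scaleN1r addNr.
Qed.

End Spectrum.

(** * Singular vectors of gl(n)-modules *)

Section GlModules.
Variables (F : fieldType) (n : nat) (X : lmodType F).
Variable E : 'I_n -> 'I_n -> {linear X -> X}.

Definition gl_relations : Prop := forall a b c d x,
  E a b (E c d x)
    = E c d (E a b x) + (b == c)%:R *: E a d x - (d == a)%:R *: E c b x.

Definition gl_stable (Z : X -> Prop) : Prop :=
  subspace Z /\ forall a b x, Z x -> Z (E a b x).

Definition has_weight (lam : 'I_n -> F) (x : X) : Prop :=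
  forall a, E a a x = lam a *: x.

Definition singular_mod (Z : X -> Prop) (x : X) : Prop :=
  forall a b : 'I_n, (a < b)%N -> Z (E a b x).

Definition singular (x : X) : Prop :=
  forall a b : 'I_n, (a < b)%N -> E a b x = 0.

Definition torus (c : 'I_n -> F) (x : X) : X := \sum_a c a *: E a a x.

Lemma torus_linear c : linear (torus c).
Proof.
move=> k x y; rewrite scaler_sumr -big_split; apply: eq_bigr => a _ /=.
by rewrite linearP scalerDr !scalerA mulrC.
Qed.
HB.instance Definition _ c := GRing.isLinear.Build F X X _ (torus c)
  (torus_linear c).

Lemma torus_weight c lam x :
  has_weight lam x -> torus c x = (\sum_a c a * lam a) *: x.
Proof.
by move=> wx; rewrite scaler_suml; apply: eq_bigr => a _; rewrite wx scalerA.
Qed.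

(** Diagonalizability of the torus with finitely many weights, in a form that
    passes to subspaces. *)
Definition torus_split (Z : X -> Prop) : Prop := forall c,
  exists2 rs, uniq rs & forall x, Z x -> spectral (torus c) rs x = 0.

(** A pair [(a, b)] encodes the root eps_a - eps_b. *)
Definition root_sum (s : seq ('I_n * 'I_n)) (c : 'I_n) : F :=
  \sum_(p <- s) ((c == p.1)%:R - (c == p.2)%:R).

Definition positive (s : seq ('I_n * 'I_n)) : bool :=
  all (fun p : 'I_n * 'I_n => p.1 < p.2)%N s.

Lemma sum_root_sum (phi : 'I_n -> F) s :
  \sum_c root_sum s c * phi c = \sum_(p <- s) (phi p.1 - phi p.2).
Proof.
under eq_bigr do rewrite mulr_suml.
rewrite exchange_big /=; apply: eq_bigr => p _.
under eq_bigr do rewrite mulrBl.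
rewrite sumrB (bigD1 p.1) //= big1 => [|c /negPf->]; last by rewrite mul0r.
rewrite [X in _ - X](bigD1 p.2) //= [X in _ - (_ + X)]big1 => [|c /negPf->].
  by rewrite !eqxx !mul1r !addr0.
by rewrite mul0r.
Qed.

Hypothesis charF : [pchar F] =i pred0.
Hypothesis glE : gl_relations.

Let natF0 m : (m%:R == 0 :> F) = (m == 0)%N.
Proof. by move/pcharf0P: charF => ->. Qed.

Lemma weight_E lam x a b :
  has_weight lam x ->
  has_weight (fun c => lam c + ((c == a)%:R - (c == b)%:R)) (E a b x).
Proof.
move=> wx c; rewrite glE wx linearZ /= -addrA scalerDl scalerBl.
congr (_ + (_ - _)); last by rewrite eq_sym; case: eqP => [->|]; rewrite ?scale0r.
by case: eqP => [->|]; rewrite ?scale0r.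
Qed.

Lemma exists_weight (Z Z' : X -> Prop) x :
    gl_stable Z -> torus_split Z -> subspace Z' -> Z x -> ~ Z' x ->
  exists y lam, [/\ Z y, ~ Z' y & has_weight lam y].
Proof.
move=> [subZ EZ] splitZ subZ' Zx nZ'x.
suff [y [Zy nZ'y wy]] : exists y,
    [/\ Z y, ~ Z' y & forall a, a \in enum 'I_n -> exists r, E a a y = r *: y].
  exists y, (fun a => sval (cid (wy a (mem_enum _ a)))); split=> // a.
  by case: cid.
elim: (enum _) => [|a s [y [Zy nZ'y wy]]]; first by exists x.
pose Zs z := Z z /\ forall b, b \in s -> 
    exists r, E b b y = r *: y /\ E b b z = r *: z.
have subZs : subspace Zs.
  split=> [|c u v [Zu wu] [Zv wv]]; split.
  - exact: subZ.1.
  - by move=> b /wy[r ?]; exists r; rewrite linear0 scaler0.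
  - exact: subZ.2.
  move=> b bs; have [r [yr ur]] := wu b bs; have [r' [yr' vr']] := wv b bs.
  exists r; split=> //; rewrite linearP /= ur vr'.
  suff -> : r' = r by rewrite scalerDr !scalerA mulrC.
  have /eqP := yr; rewrite yr' -subr_eq0 -scalerBl scaler_eq0 subr_eq0.
  case/orP=> [/eqP//|/eqP y0]; case: nZ'y; rewrite y0; exact: subZ'.1.
have tE z : torus (fun c => (c == a)%:R) z = E a a z.
  rewrite /torus (bigD1 a) //= eqxx scale1r big1 ?addr0 // => c /negPf->.
  by rewrite scale0r.
have TZs z : Zs z -> Zs (torus (fun c => (c == a)%:R) z).
  rewrite tE => -[Zz wz]; split; first exact: EZ.
  move=> b bs; have [r [yr zr]] := wz b bs; exists r; split=> //.
  rewrite glE zr linearZ /=; case: (eqVneq b a) => [->|]; last by rewrite !scale0r addr0 subr0.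
  by rewrite addrK.
have [rs uniq_rs rsP] := splitZ (fun c => (c == a)%:R).
have Zsy : Zs y by split=> // b /wy[r ?]; exists r.
have [r [z [[Zz wz] nZ'z]]] :=
  eigenvector_outside subZs TZs subZ' uniq_rs Zsy nZ'y (rsP y Zy).
move=> Tz; have {}Tz : E a a z = r *: z by rewrite -tE.
exists z; split=> // b; rewrite in_cons.
by case/predU1P => [->|/wz[r' []]]; [exists r | exists r'].
Qed.

Lemma nat_eventually_notin (rs : seq F) (d : F) :
  exists N, forall k, (N <= k)%N -> d + k%:R \notin rs.
Proof.
elim: rs => [|r rs [N NP]]; first by exists 0%N.
have [[k0 k0P]|no] := pselect (exists k0 : nat, d + k0%:R = r); last first.
  exists N => k Nk; rewrite in_cons negb_or NP // andbT.
  by apply/eqP => e; apply: no; exists k.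
exists (maxn N k0.+1) => k; rewrite geq_max => /andP[Nk k0k].
rewrite in_cons negb_or NP // andbT -k0P.
rewrite -subr_eq0 opprD addrACA subrr add0r -natrB ?natF0 ?subn_eq0 -?ltnNge //.
exact: ltnW.
Qed.

(** Raising operators increase - \sum_a a lam_a by positive integers, and this
    quantity takes finitely many values on the weights of [Z]; so a weight
    vector outside [Z'] can only be raised finitely often. *)
Lemma exists_singular_mod (Z Z' : X -> Prop) x lam :
    gl_stable Z -> torus_split Z -> subspace Z' ->
    Z x -> ~ Z' x -> has_weight lam x ->
  exists y s, [/\ Z y, ~ Z' y, positive s,
    has_weight (fun c => lam c + root_sum s c) y & singular_mod Z' y].
Proof.
move=> [subZ EZ] splitZ subZ' Zx nZ'x wx; apply: contrapT => no.
pose ht (c : 'I_n) : F := - c%:R.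
have [rs _ rsP] := splitZ ht.
have [N NP] := nat_eventually_notin rs (\sum_c ht c * lam c).
have [y [s [Zy nZ'y pos_s wy size_s]]] : exists y s, [/\ Z y, ~ Z' y, positive s,
    has_weight (fun c => lam c + root_sum s c) y & size s = N].
  elim: N {NP} => [|N [y [s [Zy nZ'y pos_s wy <-]]]].
    exists x, [::]; split=> // a; rewrite wx /root_sum big_nil addr0 //.
  have [sy|] := pselect (singular_mod Z' y); first by case: no; exists y, s.
  move=> /existsNP[a] /existsNP[b] /not_implyP[ab nZE].
  exists (E a b y), ((a, b) :: s); split=> //=; [exact: EZ | by rewrite ab |].
  move=> c; rewrite (weight_E a b wy); congr (_ *: _).
  by rewrite /root_sum big_cons /= -addrA; congr (_ + _); rewrite addrC.
have [k Nk kP] : exists2 k, (N <= k)%N &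
    \sum_c ht c * (lam c + root_sum s c) = \sum_c ht c * lam c + k%:R.
  exists (\sum_(p <- s) (p.2 - p.1))%N.
    rewrite -size_s -sum1_size; elim: s pos_s {wy size_s} => [|p s IH] /=.
      by rewrite !big_nil.
    by case/andP=> lt_p /IH le_s; rewrite !big_cons leq_add // subn_gt0.
  rewrite (eq_bigr (fun c => ht c * lam c + root_sum s c * ht c)) => [|c _].
    rewrite big_split /= sum_root_sum natr_sum; congr (_ + _).
    elim: s pos_s {wy size_s} => [|p s IH] /=; first by rewrite !big_nil.
    case/andP=> lt_p /IH eq_s; rewrite !big_cons eq_s; congr (_ + _).
    by rewrite natrB 1?ltnW // /ht opprK addrC.
  by rewrite mulrDr [root_sum _ _ * _]mulrC.
have /negP[] := NP k Nk; rewrite -kP.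
apply: eigenvalue_in_spectrum (rsP y Zy) (torus_weight _ wy) _.
by apply/eqP => y0; apply: nZ'y; rewrite y0; exact: subZ'.1.
Qed.

Lemma weight_iter_lower lam x (a b : 'I_n) r : a != b -> has_weight lam x ->
  E a a (iter r (E b a) x) = (lam a - r%:R) *: iter r (E b a) x /\
  E b b (iter r (E b a) x) = (lam b + r%:R) *: iter r (E b a) x.
Proof.
move=> /negPf ab wx; elim: r => [|r [IHa IHb]] /=; first by rewrite !wx subr0 addr0.
rewrite !(glE _ _ b a) !eqxx ab !scale0r !scale1r addr0 subr0 IHa IHb.
rewrite !linearZ !mulrS /=; split.
  by rewrite -[X in _ - X]scale1r -scalerBl; congr (_ *: _); ring.
by rewrite -[X in _ + X]scale1r -scalerDl; congr (_ *: _); ring.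
Qed.

(** The identity E_ab E_ba^(r+1) x = (r+1)(m - r) E_ba^r x modulo [Z'], where
    m = lam_a - lam_b, and the finiteness of the weights force m to be the
    natural number at which the lowering sequence enters [Z']. *)
Lemma dominance (Z Z' : X -> Prop) x lam :
    gl_stable Z -> torus_split Z -> gl_stable Z' ->
    Z x -> ~ Z' x -> has_weight lam x -> singular_mod Z' x ->
  forall a b : 'I_n, (a < b)%N ->
  exists2 m, lam a = lam b + m%:R & Z' (iter m.+1 (E b a) x).
Proof.
move=> [subZ EZ] splitZ [subZ' EZ'] Zx nZ'x wx sx a b ab.
have neq_ab : a != b by apply: contraTneq ab => ->; rewrite ltnn.
have eq_ba : (b == a) = false by rewrite eq_sym; apply: negPf.
have Zf r : Z (iter r (E b a) x) by elim: r => //= r; exact: EZ.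
have [r Z'r] : exists r, Z' (iter r (E b a) x).
  apply: contrapT => no; have [rs _ rsP] := splitZ (fun c => (c == b)%:R).
  have [N NP] := nat_eventually_notin rs (lam b).
  have /negP[] := NP N (leqnn N).
  apply: (eigenvalue_in_spectrum (rsP _ (Zf N))).
    rewrite /= /torus (bigD1 b) //= big1 ?addr0 => [|c /negPf->]; last by rewrite scale0r.
    by rewrite eqxx scale1r (weight_iter_lower N neq_ab wx).2.
  by apply/eqP => y0; apply: no; exists N; rewrite y0; exact: subZ'.1.
have [m m1 mlt] : exists2 m, Z' (iter m.+1 (E b a) x) & ~ Z' (iter m (E b a) x).
  elim: r Z'r => [//|r IH] Z'r; have [/IH//|nZ'] := pselect (Z' (iter r (E b a) x)).
  by exists r.
exists m => //; clear r Z'r.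
have key r : exists2 z, Z' z & E a b (iter r.+1 (E b a) x)
    = (r.+1%:R * (lam a - lam b - r%:R)) *: iter r (E b a) x + z.
  elim: r => [|r [z Z'z IH]].
    exists (E b a (E a b x)); first by apply: EZ'; apply: sx.
    rewrite /= glE !eqxx !wx !scale1r -addrA addrC; congr (_ + _).
    by rewrite -scalerBl mul1r subr0.
  exists (E b a z); first exact: EZ'.
  rewrite [iter r.+2 _ _]/= glE [E a b _]IH !eqxx !scale1r linearP /=.
  have [wa wb] := weight_iter_lower r.+1 neq_ab wx.
  rewrite -/(iter r.+1 (E b a) x) in wa wb *.
  rewrite [E a a _]wa [E b b _]wb -!addrA [E b a z + _]addrC addrA; congr (_ + _).
  rewrite -!scalerBl -scalerDl; congr (_ *: _).
  by rewrite !mulrS; ring.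
have [z Z'z eqz] := key m.
have Z'k : Z' ((m.+1%:R * (lam a - lam b - m%:R)) *: iter m (E b a) x).
  rewrite -[_ *: _](addrK z) -eqz; apply: subspaceB => //.
  by apply: EZ'.
have [/eqP|nz] := eqVneq (m.+1%:R * (lam a - lam b - m%:R)) 0.
  by rewrite mulf_eq0 natF0 /= !subr_eq0 => /eqP/(canRL (subrK _)); rewrite addrC.
case: mlt; rewrite -[iter _ _ _]scale1r -(mulVf nz) -scalerA.
exact: subspaceZ.
Qed.

Definition casimir (c : F) (x : X) : X :=
  \sum_a \sum_b E a b (E b a x) - c *: x.

Lemma casimir_linear c : linear (casimir c).
Proof.
move=> k x y; rewrite /casimir scalerBr scalerDr opprD addrACA; congr (_ + _).
  rewrite scaler_sumr -big_split; apply: eq_bigr => a _ /=.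
  rewrite scaler_sumr -big_split; apply: eq_bigr => b _ /=.
  by rewrite !linearP.
by rewrite !scalerA mulrC.
Qed.
HB.instance Definition _ c := GRing.isLinear.Build F X X _ (casimir c)
  (casimir_linear c).

Lemma sum_delta (I : finType) (G : I -> X) i :
  \sum_j (i == j)%:R *: G j = G i.
Proof.
rewrite (bigD1 i) //= eqxx scale1r big1 ?addr0 // => j.
by rewrite eq_sym => /negPf->; rewrite scale0r.
Qed.

Lemma casimir_comm c a b x : E a b (casimir c x) = casimir c (E a b x).
Proof.
rewrite /casimir linearB linearZ linear_sum /=; congr (_ - _).
pose A i j := E i j (E j i (E a b x)).
pose B i j := (b == j)%:R *: E i j (E a i x).
pose C i j := (a == i)%:R *: E i j (E j b x).
pose D i j := (b == i)%:R *: E a j (E j i x).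
pose G i j := (a == j)%:R *: E i b (E j i x).
have termE i j : E a b (E i j (E j i x)) = A i j + B i j - C i j + D i j - G i j.
  rewrite glE [E a b (E j i x)]glE /A /B /C /D /G linearB linearD !linearZ /=.
  by rewrite [i == a]eq_sym [j == a]eq_sym.
rewrite (eq_bigr (fun i => \sum_j (A i j + B i j - C i j + D i j - G i j))); last first.
  by move=> i _; rewrite linear_sum; apply: eq_bigr => j _; rewrite termE.
under eq_bigr do rewrite sumrB big_split sumrB big_split /=.
rewrite sumrB big_split sumrB big_split /=.
have -> : \sum_i \sum_j B i j = \sum_i E i b (E a i x).
  by apply: eq_bigr => i _; rewrite sum_delta.
have -> : \sum_i \sum_j G i j = \sum_i E i b (E a i x).
  by apply: eq_bigr => i _; rewrite (sum_delta (fun j => E i b (E j i x))).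
have -> : \sum_i \sum_j C i j = \sum_j E a j (E j b x).
  rewrite exchange_big; apply: eq_bigr => j _.
  by rewrite (sum_delta (fun i => E i j (E j b x))).
have -> : \sum_i \sum_j D i j = \sum_j E a j (E j b x).
  rewrite exchange_big; apply: eq_bigr => j _.
  by rewrite (sum_delta (fun i => E a j (E j i x))).
by rewrite subrK addrK.
Qed.

(** Twice the a-th coordinate of the half sum of the positive roots. *)
Definition two_rho (a : 'I_n) : F := \sum_(b < n) ((a < b)%N%:R - (b < a)%N%:R).

Definition casimir_value (lam : 'I_n -> F) : F :=
  \sum_a lam a * (lam a + two_rho a).

Lemma casimir_singular_mod (Z' : X -> Prop) x lam : gl_stable Z' ->
  has_weight lam x -> singular_mod Z' x -> Z' (casimir (casimir_value lam) x).
Proof.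
move=> [subZ' EZ'] wx sx.
pose u (a b : 'I_n) : F := if (a < b)%N then lam a - lam b
  else if a == b then lam a ^+ 2 else 0.
have cvE : casimir_value lam = \sum_a \sum_b u a b.
  pose v (a b : 'I_n) : F := (a == b)%:R * lam a ^+ 2.
  pose l (a b : 'I_n) : F := (a < b)%N%:R * lam a.
  pose l' (a b : 'I_n) : F := (a < b)%N%:R * lam b.
  have uE a b : u a b = v a b + (l a b - l' a b).
    rewrite /u /v /l /l'; case: (ltngtP a b) => [ab|ab|/val_inj->].
    - by rewrite -(inj_eq val_inj) /= ltn_eqF // mul0r add0r !mul1r.
    - by rewrite -(inj_eq val_inj) /= gtn_eqF // !mul0r subrr addr0.
    by rewrite eqxx !mul0r subrr addr0 mul1r.
  under [RHS]eq_bigr do rewrite (eq_bigr _ (fun b _ => uE _ b)) big_split sumrB /=.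
  rewrite big_split sumrB /= [X in _ = _ + (_ - X)]exchange_big /= -sumrB -big_split.
  apply: eq_bigr => a _ /=; rewrite mulrDr -expr2; congr (_ + _).
    rewrite /v (bigD1 a) //= eqxx mul1r big1 ?addr0 // => b.
    by rewrite eq_sym => /negPf->; rewrite mul0r.
  rewrite /two_rho mulr_sumr -sumrB; apply: eq_bigr => b _.
  by rewrite mulrBr /l /l' ![lam a * _]mulrC.
rewrite /casimir cvE scaler_suml -sumrB; apply: subspace_sum => // a _.
rewrite scaler_suml -sumrB; apply: subspace_sum => // b _.
rewrite /u; case: (ltngtP a b) => [ab|ab|/val_inj->].
- rewrite glE !eqxx !scale1r !wx -[X in X - _]addrA -scalerBl addrK.
  by apply: EZ'; apply: sx.
- rewrite -(inj_eq val_inj) /= gtn_eqF // scale0r subr0.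
  by apply: EZ'; apply: sx.
by rewrite eqxx !wx linearZ /= wx scalerA expr2 subrr; exact: subZ'.1.
Qed.

(** The difference is a sum over the roots of [s].  With lam' = lam + root_sum s,
    the root eps_a - eps_b contributes
    (lam_a - lam_b) + (lam'_a - lam'_b) + 2 (b - a), a positive integer. *)
Lemma casimir_value_neq lam s : positive s -> s != [::] ->
    (forall a b : 'I_n, (a < b)%N -> exists m, lam a = lam b + m%:R) ->
    (forall a b : 'I_n, (a < b)%N ->
       exists m, lam a + root_sum s a = lam b + root_sum s b + m%:R) ->
  casimir_value (fun c => lam c + root_sum s c) != casimir_value lam.
Proof.
move=> pos_s nz_s dom1 dom2; rewrite -subr_eq0 -sumrB.
rewrite (eq_bigr (fun c => root_sum s c *
  (lam c + (lam c + root_sum s c) + two_rho c))); last by move=> c _; ring.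
rewrite sum_root_sum; apply: contraNneq nz_s => sum0.
suff [m mpos sumE] : exists2 m, (size s <= m)%N & \sum_(p <- s)
    (lam p.1 + (lam p.1 + root_sum s p.1) + two_rho p.1
     - (lam p.2 + (lam p.2 + root_sum s p.2) + two_rho p.2)) = m%:R :> F.
  move: sum0; rewrite sumE => /eqP; rewrite natF0 => m0.
  by rewrite -size_eq0 -leqn0 -(eqP m0).
elim: {1 2 3}s pos_s {sum0} => [_|p r IH /= /andP[lt_p /IH[m le_m eq_m]]].
  by exists 0%N; rewrite ?big_nil.
have [m1 e1] := dom1 _ _ lt_p; have [m2 e2] := dom2 _ _ lt_p.
have [k e3] : exists k, two_rho p.1 = two_rho p.2 + k.+1%:R.
  pose g (b : 'I_n) := ((p.1 < b <= p.2) + (p.1 <= b < p.2))%N.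
  exists (\sum_b g b).-1; rewrite prednK; last first.
    by rewrite (bigD1 p.2) //= /g lt_p leqnn.
  apply/eqP; rewrite addrC -subr_eq /two_rho -sumrB natr_sum; apply/eqP.
  apply: eq_bigr => b _; rewrite /g.
  rewrite natrD; case: (ltngtP p.1 b); case: (ltngtP p.2 b) => //= h1 h2;
    rewrite ?mulr0n ?mulr1n; try ring; exfalso; lia.
exists (m1 + m2 + k.+1 + m)%N; first by rewrite addnS addSn ltnS (leq_trans le_m) // leq_addl.
by rewrite big_cons eq_m e2 e1 e3 !natrD; ring.
Qed.

(** Stated through linear relations, so that it passes to subspaces. *)
Definition finite_dimensional (Z : X -> Prop) : Prop := exists N,
  forall y : 'I_N -> X, (forall i, Z (y i)) ->
  exists2 p : 'I_N -> F, (exists i, p i != 0) & \sum_i p i *: y i = 0.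

Lemma iter_linear (T : {linear X -> X}) r : linear (iter r T).
Proof. by move=> c x y; elim: r => //= r ->; rewrite linearP. Qed.

(** Singular vectors lift from a quotient: the Casimir operator acts on the
    class of [x] by a scalar, so [x] can be corrected inside [Z'] to a
    generalized eigenvector.  Raising this eigenvector would lead to a singular
    vector of larger dominant weight with the same Casimir value. *)
Lemma exists_singular_outside (Z Z' : X -> Prop) x :
    gl_stable Z -> torus_split Z -> finite_dimensional Z ->
    gl_stable Z' -> (forall y, Z' y -> Z y) -> Z x -> ~ Z' x ->
  exists y lam, [/\ Z y, ~ Z' y, has_weight lam y & singular y].
Proof.
move=> stZ splitZ [N dimZ] stZ' Z'Z Zx nZ'x.
have [subZ EZ] := stZ; have [subZ' EZ'] := stZ'.
have [{Zx nZ'x}x [{}lam [Zx nZ'x wx]]] := exists_weight stZ splitZ subZ' Zx nZ'x.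
have [{Zx nZ'x wx}x [s [Zx nZ'x _ wx sx]]] :=
  exists_singular_mod stZ splitZ subZ' Zx nZ'x wx.
move: (fun c => lam c + root_sum s c) wx => {s}lam wx.
have dom := dominance stZ splitZ stZ' Zx nZ'x wx sx.
pose T : {linear X -> X} := casimir (casimir_value lam).
have TW (W : X -> Prop) : gl_stable W -> forall y, W y -> W (T y).
  move=> [subW EW] y Wy; rewrite /T /= /casimir.
  apply: subspaceB => //; last exact: subspaceZ.
  by apply: subspace_sum => // a _; apply: subspace_sum => // b _; exact/EW/EW.
have TiZ i : Z (iter i T x) by elim: i => //= i; exact: TW.
have TiZ' i : Z' (iter i.+1 T x).
  by elim: i => [|i IH] /=; [exact: casimir_singular_mod | exact: TW].
have ET i a b y : E a b (iter i T y) = iter i T (E a b y).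
  by elim: i => //= i <-; exact: casimir_comm.
have iterTD i y z : iter i T (y + z) = iter i T y + iter i T z.
  by have := iter_linear T i 1 y z; rewrite !scale1r.
have iter0 i : iter i T 0 = 0 by elim: i => //= i ->; rewrite linear0.
have iterZ i c y : iter i T (c *: y) = c *: iter i T y.
  by have := iter_linear T i c y 0; rewrite iter0 !addr0.
have [r [y [nil_y eq_y Zy wy]]] : exists r y,
    [/\ iter r T y = 0, Z' (y - x), Z y & has_weight lam y].
  have [p [i0 nz_p] sum0] := dimZ (fun i => iter i T x) (fun i => TiZ i).
  have [/= r nz_r min_r] := @arg_minnP 'I_N i0 (fun i => p i != 0) (@nat_of_ord N) nz_p.
  pose y := \sum_(i < N | (r <= i)%N) (p i / p r) *: iter (i - r) T x.
  exists r, y; split.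
  - have -> : iter r T y = (p r)^-1 *: \sum_i p i *: iter i T x.
      rewrite [in RHS](bigID (fun i : 'I_N => r <= i)%N) /= [X in _ + X]big1 ?addr0.
        rewrite scaler_sumr /y.
        elim/big_rec2: _ => [|i z1 z2 ri IH]; first by rewrite iter0.
        by rewrite iterTD IH iterZ scalerA -iterD subnKC // [_ / _]mulrC.
      move=> i; case: (eqVneq (p i) 0) => [->|/min_r->//].
      by rewrite scale0r.
    by rewrite sum0 scaler0.
  - rewrite /y (bigD1 r) //= subnn divff // scale1r [_ - x]addrC /= addKr.
    apply: subspace_sum => // i /andP[ri neq_ir]; apply: subspaceZ => //.
    have: (0 < i - r)%N by rewrite subn_gt0 ltn_neqAle ri andbT eq_sym.
    by case: (i - r)%N.
  - by apply: subspace_sum => // i _; apply: subspaceZ.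
  move=> a; rewrite /y linear_sum scaler_sumr; apply: eq_bigr => i _.
  by rewrite linearZ /= ET wx iterZ !scalerA mulrC.
have nZ'y : ~ Z' y.
  by move=> Z'y; apply: nZ'x; rewrite -[x](subKr y); exact: subspaceB.
have [sy|] := pselect (singular y); first by exists y, lam.
move=> /existsNP[a] /existsNP[b] /not_implyP[ab /eqP nzE].
pose Z0 z := Z z /\ iter r T z = 0.
have stZ0 : gl_stable Z0.
  split; first split.
  - by split; [exact: subZ.1 | exact: iter0].
  - move=> c u v [Zu u0] [Zv v0]; split; first exact: subZ.2.
    by rewrite iter_linear u0 v0 scaler0 addr0.
  by move=> c d u [Zu u0]; split; [exact: EZ | rewrite -ET u0 linear0].
have splitZ0 : torus_split Z0.
  by move=> c; have [rs ? rsP] := splitZ c; exists rs => // z [/rsP].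
have stO : gl_stable (fun z => z = 0).
  split; first by split=> // c u v -> ->; rewrite scaler0 addr0.
  by move=> c d u ->; rewrite linear0.
have Z0y : Z0 (E a b y) by split; [exact: EZ | rewrite -ET nil_y linear0].
have wE := weight_E a b wy.
have [z [s [[Zz Tz] nz_z pos_s wz sz]]] :=
  exists_singular_mod stZ0 splitZ0 stO.1 Z0y (elimN eqP nzE) wE.
have wz' : has_weight (fun c => lam c + root_sum ((a, b) :: s) c) z.
  by move=> c; rewrite wz /root_sum big_cons /= -[in LHS]addrA.
have dom' := dominance stZ splitZ stO Zz nz_z wz' sz.
have pos_s' : positive ((a, b) :: s) by rewrite /= ab.
have /negP[] := casimir_value_neq pos_s' isT
  (fun a b ab => let: ex_intro2 m e _ := dom a b ab in ex_intro _ m e)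
  (fun a b ab => let: ex_intro2 m e _ := dom' a b ab in ex_intro _ m e).
have := casimir_singular_mod stO wz' sz; set c' := casimir_value _ => Cz.
have {}Cz : T z = (c' - casimir_value lam) *: z.
  rewrite scalerBl; move/eqP: Cz; rewrite subr_eq0 => /eqP <-.
  by [].
have iterE i : iter i T z = (c' - casimir_value lam) ^+ i *: z.
  elim: i => [|i IH]; first by rewrite scale1r.
  by rewrite iterSr Cz iterZ IH scalerA exprS.
move/eqP: Tz; rewrite iterE scaler_eq0 expf_eq0 subr_eq0.
by case/orP=> [/andP[_ //]|/eqP].
Qed.

End GlModules.

(** * Insertion of a box by vector operators *)

Lemma big_ord_lt_recr (R : Type) (idx : R) (op : Monoid.com_law idx) n
    (G : 'I_n -> R) c (lt_cn : (c < n)%N) :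
  \big[op/idx]_(l < n | (l < c.+1)%N) G l
    = op (G (Ordinal lt_cn)) (\big[op/idx]_(l < n | (l < c)%N) G l).
Proof.
rewrite (bigD1 (Ordinal lt_cn)) //=; congr (op _ _); apply: eq_bigl => l.
by rewrite -(inj_eq val_inj) /= ltnS andbC -ltn_neqAle.
Qed.

Lemma card_ord_interval n (a b : 'I_n) : (a <= b)%N ->
  (\sum_(l < n | a <= l < b) 1)%N = (b - a)%N.
Proof.
suff H c : (c <= n)%N -> (\sum_(l < n | a <= l < c) 1)%N = (c - a)%N.
  by move=> _; apply: H; apply: ltnW.
elim: c => [_|c IH lt_cn].
  by rewrite big_pred0 // => l; rewrite ltn0 andbF.
have [le_ac|lt_ca] := leqP a c; last first.
  rewrite big_pred0 => [|l]; first lia.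
  by apply/negP; lia.
rewrite (bigD1 (Ordinal lt_cn)) /=; last by rewrite le_ac leqnn.
rewrite (eq_bigl (fun l : 'I_n => a <= l < c)%N) => [|l].
  by rewrite IH 1?ltnW // add1n subSn.
by rewrite -(inj_eq val_inj) /=; apply/idP/idP; lia.
Qed.

Section VectorOperators.
Variables (F : fieldType) (n : nat) (X : lmodType F).
Variable E : 'I_n -> 'I_n -> {linear X -> X}.
Hypothesis glE : gl_relations E.
Variable xop : 'I_n -> {linear X -> X}.
Hypothesis glx : forall a b c u,
  E a b (xop c u) = xop c (E a b u) + (b == c)%:R *: xop a u.
Variables (w : X) (lam : 'I_n -> F) (j : 'I_n).
Hypotheses (ww : has_weight E lam w) (sw : singular E w).
Let t (c : 'I_n) : F := lam c - c%:R.
Hypothesis neq_t : forall c : 'I_n, (c < j)%N -> t j - t c != 0.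

Let step (h : 'I_n -> X) (c : 'I_n) : X :=
  xop c w + \sum_(l < n | (l < c)%N) E c l (h l).

Let exists_resolvent : exists h : 'I_n -> X,
  forall c : 'I_n, (c < j)%N -> (t j - t c) *: h c = step h c.
Proof.
suff H k : exists h : 'I_n -> X, forall c : 'I_n, (c < j)%N -> (c < k)%N ->
    (t j - t c) *: h c = step h c.
  by have [h hP] := H n; exists h => c cj; apply: hP.
elim: k => [|k [h hP]]; first by exists (fun=> 0).
exists (fun c : 'I_n => if c == k :> nat then (t j - t c)^-1 *: step h c else h c).
move=> c cj; rewrite ltnS leq_eqVlt => ck.
have stepE : step (fun c : 'I_n => if c == k :> nat then (t j - t c)^-1 *: step h c
    else h c) c = step h c.
  congr (_ + _); apply: eq_bigr => l lc; rewrite ltn_eqF //.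
  by case/predU1P: ck => [<-//|]; apply: ltn_trans.
rewrite stepE; case: eqP ck => [ck _|_ /=]; last exact: hP.
by rewrite scalerA divff ?scale1r // neq_t.
Qed.

Section Resolvent.
Variable h : 'I_n -> X.
Hypothesis hP : forall c : 'I_n, (c < j)%N -> (t j - t c) *: h c = step h c.

Let h_step (c : 'I_n) : (c < j)%N -> h c = (t j - t c)^-1 *: step h c.
Proof. by move=> cj; rewrite -hP // scalerA mulVf ?scale1r // neq_t. Qed.

Lemma row_step_weight (c : 'I_n) : (c <= j)%N ->
  has_weight E (fun a => lam a + (a == c)%:R) (step h c).
Proof.
have [m] := ubnP (nat_of_ord c); elim: m c => // m IH c; rewrite ltnS => cm cj a.
rewrite linearD linear_sum /= glx ww linearZ /= scalerDr scaler_sumr.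
rewrite [(_ + _) *: xop c w]scalerDl; congr (_ + _ + _).
  by case: eqP => [->|]; rewrite ?scale0r.
apply: eq_bigr => l lc.
have wl : has_weight E (fun a => lam a + (a == l)%:R) (h l).
  have lj := leq_trans lc cj.
  move=> b; rewrite (h_step lj) linearZ /= (IH l _ (ltnW lj)) ?(leq_trans lc) //.
  by rewrite !scalerA mulrC.
by rewrite (weight_E glE c l wl); congr (_ *: _); ring.
Qed.

Lemma row_step_raise (c a b : 'I_n) : (c <= j)%N -> (a < b)%N ->
  E a b (step h c) = (b == c)%:R *: ((t j - t b) *: h a).
Proof.
have [m] := ubnP (nat_of_ord c); elim: m c a b => // m IH c a b.
rewrite ltnS => cm cj ab.
have raise_h (l p q : 'I_n) : (l < c)%N -> (p < q)%N ->
    E p q (h l) = (q == l)%:R *: h p.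
  move=> lc pq; have lj := leq_trans lc cj.
  rewrite (h_step lj) linearZ /= (IH l _ _ _ (ltnW lj) pq) ?(leq_trans lc) //.
  case: (eqVneq q l) => [->|_]; last by rewrite !scale0r scaler0.
  by rewrite !scale1r scalerA mulVf ?scale1r // neq_t.
have -> : E a b (step h c) = (b == c)%:R *: xop a w +
    \sum_(l < n | (l < c)%N) (((b == c)%:R *: E a l (h l)) +
      ((b == l)%:R *: E c b (h a) - (l == a)%:R *: E c b (h a))).
  rewrite linearD linear_sum /= glx (sw ab) linear0 add0r; congr (_ + _).
  apply: eq_bigr => l lc; rewrite glE raise_h // linearZ /= -addrA addrCA.
  congr (_ + (_ - _)); first by case: eqP => [->|]; rewrite ?scale0r.
  by case: eqP => [->|]; rewrite ?scale0r.
rewrite big_split sumrB /= -!scaler_suml.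
have deltaE (i : 'I_n) : \sum_(l < n | (l < c)%N) (l == i)%:R = (i < c)%N%:R :> F.
  case: (ltnP i c) => ic.
    by rewrite (bigD1 i) //= eqxx big1 ?addr0 // => l /andP[_ /negPf->].
  rewrite big1 // => l lc; case: eqP => // li; move: lc; rewrite li ltnNge ic //.
rewrite (eq_bigr (fun l => (l == b)%:R)) => [|l _]; last by rewrite eq_sym.
rewrite !deltaE; have [bc|neq_bc] := eqVneq b c; last first.
  rewrite !scale0r add0r big1 ?add0r => [|l _]; last by rewrite scale0r.
  case: (ltngtP b c) => [bc|cb|/val_inj/eqP]; last by rewrite (negPf neq_bc).
    by rewrite (ltn_trans ab bc) subrr.
  rewrite scale0r; case: ltnP => ac; last by rewrite scale0r subr0.
  rewrite raise_h // (negPf (_ : b != a)) ?scale0r ?scaler0 ?subr0 //.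
  by apply: contraTneq ab => ->; rewrite ltnn.
subst c; rewrite ltnn scale0r sub0r ab !scale1r.
under eq_bigr do rewrite scale1r.
have aj : (a < j)%N := leq_trans ab cj.
have wa : has_weight E (fun c => lam c + (c == a)%:R) (h a).
  move=> c; rewrite (h_step aj) linearZ /= (row_step_weight (ltnW aj)).
  by rewrite !scalerA mulrC.
rewrite wa (negPf (_ : b != a)); last by apply: contraTneq ab => ->; rewrite ltnn.
rewrite (bigID (fun l : 'I_n => l < a)%N) /=.
rewrite (eq_bigl (fun l : 'I_n => l < a)%N) => [|l]; last first.
  by apply/andP/idP => [[]//|la]; split=> //; apply: ltn_trans la ab.
rewrite addrA addrA -/(step h a) -hP //.
rewrite (eq_bigr (fun l => h a + (l == a)%:R *: (lam a *: h a))); last first.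
  move=> l /andP[lb]; rewrite -leqNgt leq_eqVlt => /orP[/eqP/val_inj <-|al].
    by rewrite wa eqxx scale1r scalerDl scale1r addrC.
  by rewrite raise_h // eqxx scale1r -[l == a](inj_eq val_inj) /= gtn_eqF // scale0r addr0.
have -> : \sum_(l < n | (l < b)%N && ~~ (l < a)%N)
   (h a + (l == a)%:R *: (lam a *: h a)) = ((b - a)%:R + lam a) *: h a.
  rewrite big_split /= scalerDl; congr (_ + _).
    rewrite sumr_const -scaler_nat; congr (_%:R *: _).
    rewrite -(card_ord_interval (ltnW ab)) sum1_card; apply: eq_card => l.
    by rewrite !unfold_in /= -leqNgt andbC.
  rewrite (bigD1 a) ?ab ?ltnn //= eqxx scale1r big1 ?addr0 // => l.
  by case/andP=> _ /negPf->; rewrite scale0r.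
rewrite -!scalerDl -scaleNr -scalerDl; congr (_ *: _).
by rewrite natrB 1?ltnW // /t; ring.
Qed.

End Resolvent.

(** Row insertion: from a singular vector [w] one obtains a singular vector
    whose weight is increased at [j].  It is [xop j w] corrected by lower
    terms: the vectors [h l] solve the triangular system
    (t_j - t_l) h_l = xop l w + \sum_(i < l) E_li h_i.  The functionals [ev c],
    which see lowering operators only through the scalars [al], show that it
    is nonzero. *)
Lemma exists_row_insertion (ev : 'I_n -> X -> F) (al : 'I_n -> F) (e0 : F) :
    (forall c k u v, ev c (k *: u + v) = k * ev c u + ev c v) ->
    (forall (c l : 'I_n) u, (l < c)%N -> ev c (E c l u) = al l * ev l u) ->
    (forall c, ev c (xop c w) = e0) ->
  exists y, [/\ singular E y,
    has_weight E (fun a => lam a + (a == j)%:R) y,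
    ev j y = e0 * \prod_(l < n | (l < j)%N) ((t j - t l + al l) / (t j - t l))
    & forall Z, gl_stable E Z -> (forall c, Z (xop c w)) -> Z y].
Proof.
move=> ev_lin evE evx; have [h hP] := exists_resolvent; exists (step h j); split.
- move=> a b ab; rewrite (row_step_raise hP) //.
  by case: eqP => [->|]; rewrite ?subrr ?scale0r ?scaler0.
- exact: row_step_weight.
- have ev0 c : ev c 0 = 0.
    by have := ev_lin c (-1) 0 0; rewrite scaler0 addr0 mulN1r addNr.
  have ev_step c : ev c (step h c) = e0 + \sum_(l < n | (l < c)%N) al l * ev l (h l).
    rewrite /step -[xop c w]scale1r ev_lin mul1r evx; congr (_ + _).
    elim/big_rec2: _ => [|l y1 y2 lc <-]; first exact: ev0.
    by rewrite -[E c l _]scale1r ev_lin mul1r evE.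
  rewrite ev_step.
  suff H k : (k <= j)%N -> e0 + \sum_(l < n | (l < k)%N) al l * ev l (h l) =
      e0 * \prod_(l < n | (l < k)%N) ((t j - t l + al l) / (t j - t l)).
    exact: H.
  elim: k => [_|k IH kj].
    by rewrite !big_pred0 ?addr0 ?mulr1 // => l; rewrite ltn0.
  have kn := ltn_trans kj (ltn_ord j).
  rewrite !(big_ord_lt_recr _ _ kn) /= addrCA IH 1?ltnW //; set o := Ordinal kn.
  have oj : t j - t o != 0 by apply: neq_t.
  suff -> : ev o (h o) = (t j - t o)^-1 * (e0 * \prod_(l < n | (l < k)%N)
      ((t j - t l + al l) / (t j - t l))) by field.
  rewrite -IH 1?ltnW // -[in RHS](ev_step o) -hP //.
  by rewrite -[_ *: _]addr0 ev_lin ev0 addr0 mulrA mulVf // mul1r.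
move=> Z [subZ EZ] Zx; apply: subspaceD => //; apply: subspace_sum => // l lj.
apply/EZ; have [m] := ubnP (nat_of_ord l); elim: m l lj => // m IH l lj.
rewrite ltnS => lm; have -> : h l = (t j - t l)^-1 *: step h l.
  by rewrite -hP // scalerA mulVf ?scale1r // neq_t.
apply: subspaceZ => //; apply: subspaceD => //; apply: subspace_sum => // i il.
by apply: EZ; apply: IH; [exact: ltn_trans il lj | exact: leq_trans il lm].
Qed.

End VectorOperators.

(** * The action of sl(n+1) on polynomial tensors *)

Lemma scaler_exchange (F : fieldType) (X : lmodType F) (k c : F) (x y z t : X) :
  k *: (c *: x + y) + (c *: z + t) = c *: (k *: x + z) + (k *: y + t).
Proof. by rewrite !scalerDr !scalerA [k * c]mulrC addrACA. Qed.

Section PureTensors.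
Variables (F : fieldType) (n : nat) (V : vectType F).
Local Notation A := {mpoly F[n]}.
Local Notation M := {ffun 'I_(\dim {:V}) -> A}.
Implicit Types (f g : A) (u : V) (m : M).

Lemma pure_tensorDl f g u : pure_tensor (f + g) u = pure_tensor f u + pure_tensor g u.
Proof. by have := (pure_tensor_bilinear n V).1 u 1 f g; rewrite !scale1r. Qed.

Lemma pure_tensorDr f u w : pure_tensor f (u + w) = pure_tensor f u + pure_tensor f w.
Proof. by have := (pure_tensor_bilinear n V).2 f 1 u w; rewrite !scale1r. Qed.

Lemma pure_tensor0l u : pure_tensor (0 : A) u = 0.
Proof. exact: linear_zero ((pure_tensor_bilinear n V).1 u). Qed.

Lemma pure_tensor0r f : pure_tensor f (0 : V) = 0.
Proof. exact: linear_zero ((pure_tensor_bilinear n V).2 f). Qed.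

Lemma pure_tensorZl c f u : pure_tensor (c *: f) u = c *: pure_tensor f u.
Proof.
by have := (pure_tensor_bilinear n V).1 u c f 0; rewrite /= !pure_tensor0l !addr0.
Qed.

Lemma pure_tensorZr c f u : pure_tensor f (c *: u) = c *: pure_tensor f u.
Proof.
by have := (pure_tensor_bilinear n V).2 f c u 0; rewrite /= !pure_tensor0r !addr0.
Qed.

Lemma pure_tensor_suml (I : Type) (r : seq I) (G : I -> A) u :
  pure_tensor (\sum_(i <- r) G i) u = \sum_(i <- r) pure_tensor (G i) u.
Proof.
by elim/big_rec2: _ => [|i y1 y2 _ <-]; rewrite ?pure_tensor0l ?pure_tensorDl.
Qed.

Lemma pure_tensor_sumr (I : Type) (r : seq I) f (G : I -> V) :
  pure_tensor f (\sum_(i <- r) G i) = \sum_(i <- r) pure_tensor f (G i).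
Proof.
by elim/big_rec2: _ => [|i y1 y2 _ <-]; rewrite ?pure_tensor0r ?pure_tensorDr.
Qed.

Lemma tensor_ind (P : M -> Prop) : subspace P ->
  (forall f u, P (pure_tensor f u)) -> forall m, P m.
Proof.
by move=> subP Pp m; rewrite (poly_tensor_sum m); apply: subspace_sum.
Qed.

Lemma tensor_monomial_ind (P : M -> Prop) : subspace P ->
  (forall be u, P (pure_tensor 'X_[be] u)) -> forall m, P m.
Proof.
move=> subP Pp; apply: tensor_ind => // f u; rewrite [f]mpolyE pure_tensor_suml.
by apply: subspace_sum => // be _; rewrite pure_tensorZl; apply: subspaceZ.
Qed.

Lemma tensor_map_linear (phi : A -> A) (T : V -> V) :
  linear phi -> linear (tensor_map (n := n) phi T).
Proof.
move=> lin_phi c m1 m2; rewrite /tensor_map scaler_sumr -big_split.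
apply: eq_bigr => k _ /=; rewrite !ffunE lin_phi.
by rewrite pure_tensorDl pure_tensorZl.
Qed.

Definition mulX (c : 'I_n) (m : M) : M := [ffun k => 'X_c * m k].

Lemma mulX_linear c : linear (mulX c).
Proof.
by move=> a m1 m2; apply/ffunP => k; rewrite !ffunE mulrDr scalerAr.
Qed.
HB.instance Definition _ c := GRing.isLinear.Build F M M _ (mulX c) (mulX_linear c).

Lemma mulX_pure c f u : mulX c (pure_tensor f u) = pure_tensor ('X_c * f) u.
Proof. by apply/ffunP => k; rewrite !ffunE scalerAr. Qed.

Variable rho : {linear 'M[F]_n -> 'End(V)}.

Lemma vf_act_linear a : linear (vf_act rho a).
Proof.
have lin_mul (g : A) : linear (fun f => g * f).
  by move=> c f h; rewrite mulrDr scalerAr.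
move=> c m1 m2; rewrite /vf_act scalerDr addrACA; congr (_ + _); last first.
  exact: (tensor_map_linear _ (derivation_linear a)).
rewrite scaler_sumr -big_split; apply: eq_bigr => i _ /=.
rewrite scaler_sumr -big_split; apply: eq_bigr => j _ /=.
exact: tensor_map_linear.
Qed.
HB.instance Definition _ a := GRing.isLinear.Build F M M _ (vf_act rho a)
  (vf_act_linear a).

Lemma vf_act_linearl c a b m :
  vf_act rho (c *: a + b) m = c *: vf_act rho a m + vf_act rho b m.
Proof.
pose P m := vf_act rho (c *: a + b) m = c *: vf_act rho a m + vf_act rho b m.
suff: P m by []; move: m; apply: tensor_ind => [|f u].
  split=> [|k x y Px Py]; rewrite /P; first by rewrite !linear0 addr0.
  rewrite [LHS]vf_act_linear (vf_act_linear a) (vf_act_linear b) Px Py.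
  exact: scaler_exchange.
rewrite /P !vf_act_pure scalerDr addrACA; congr (_ + _).
  rewrite scaler_sumr -big_split; apply: eq_bigr => i _ /=.
  rewrite scaler_sumr -big_split; apply: eq_bigr => j _ /=.
  by rewrite !ffunE linearP mulrDl pure_tensorDl -scalerAl pure_tensorZl.
rewrite -pure_tensorZl -pure_tensorDl; congr pure_tensor.
rewrite /derivation scaler_sumr -big_split; apply: eq_bigr => i _ /=.
by rewrite !ffunE mulrDl scalerAl.
Qed.

Lemma sl_stable (W : M -> Prop) m a : subspace W -> W m ->
    (forall j, W (vf_act rho (vf_partial F j) m)) ->
    (forall i j, W (vf_act rho (vf_xpartial F i j) m)) ->
    (forall i, W (vf_act rho (vf_p F i) m)) ->
  sl_span a -> W (vf_act rho a m).
Proof.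
move=> subW Wm Wd We Wp [b [c [d ->]]].
pose Q a := W (vf_act rho a m).
have Q0 : Q 0.
  have := vf_act_linearl (-1) 0 0 m; rewrite scaler0 addr0 scaleN1r addNr /Q => ->.
  exact: subW.1.
have QD x y : Q x -> Q y -> Q (x + y).
  by move=> Qx Qy; rewrite /Q -[x]scale1r vf_act_linearl; apply: subW.2.
have QZ k x : Q x -> Q (k *: x).
  by move=> Qx; rewrite /Q -[k *: x]addr0 vf_act_linearl; apply: subW.2.
have Qsum (G : 'I_n -> vector_field F n) : (forall i, Q (G i)) -> Q (\sum_i G i).
  by move=> QG; apply: big_ind.
by apply/QD; [apply/QD|]; apply/Qsum => i; [|apply/Qsum => j|]; apply/QZ.
Qed.

Lemma sl_partial (j : 'I_n) : sl_span (vf_partial F j).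
Proof.
exists (fun i => (j == i)%:R), (fun _ _ => 0), (fun _ => 0).
rewrite sum_delta big1 ?addr0 => [|i _]; last by rewrite big1 // => k _; rewrite scale0r.
by rewrite big1 ?addr0 // => i _; rewrite scale0r.
Qed.

Lemma sl_xpartial (i j : 'I_n) : sl_span (vf_xpartial F i j).
Proof.
exists (fun _ => 0), (fun a b => (i == a)%:R * (j == b)%:R), (fun _ => 0).
rewrite big1 ?add0r => [|k _]; last by rewrite scale0r.
rewrite [X in _ = _ + X]big1 ?addr0 => [|k _]; last by rewrite scale0r.
under eq_bigr do under eq_bigr do rewrite -scalerA.
under eq_bigr do rewrite -scaler_sumr (sum_delta (fun b => vf_xpartial F _ b)).
by rewrite (sum_delta (fun a => vf_xpartial F a j)).
Qed.

Lemma sl_p (i : 'I_n) : sl_span (vf_p F i).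
Proof.
exists (fun _ => 0), (fun _ _ => 0), (fun k => (i == k)%:R).
rewrite big1 ?add0r => [|k _]; last by rewrite scale0r.
rewrite big1 ?add0r => [|k _]; last by rewrite big1 // => l _; rewrite scale0r.
by rewrite sum_delta.
Qed.

End PureTensors.

(** * Highest weight modules *)

Definition weighted (F : fieldType) (n : nat) (X : lmodType F)
    (E : 'I_n -> 'I_n -> {linear X -> X}) (p : X * {ffun 'I_n -> F}) : Prop :=
  has_weight E p.2 p.1.

Definition torus_values (F : fieldType) (n : nat) (X : eqType) (c : 'I_n -> F)
    (us : seq (X * {ffun 'I_n -> F})) : seq F :=
  undup [seq \sum_a c a * q.2 a | q : X * {ffun 'I_n -> F} <- us].

Section HighestWeight.
Variables (F : fieldType) (charF : [pchar F] =i pred0) (n : nat).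
Variables (V : vectType F) (rho : {linear 'M[F]_n -> 'End(V)}).
Hypotheses (V_rep : gl_representation rho) (V_irr : gl_irreducible rho).
Variables (mu : 'I_n -> F) (v : V).

Definition glV (a b : 'I_n) : {linear V -> V} := rho (delta_mx a b).

Lemma glV_relations : gl_relations glV.
Proof.
move=> a b c d u.
have := V_rep (delta_mx a b) (delta_mx c d) u.
rewrite !mul_delta_mx_cond -!scaler_nat linearB !linearZ /= add_lfunE.
rewrite !scale_lfunE opp_lfunE => /esym/eqP; rewrite subr_eq => /eqP ->.
by rewrite addrC addrA.
Qed.

Lemma glV_submodule (W : V -> Prop) u : gl_stable glV W -> W u -> u != 0 ->
  forall w, W w.
Proof.
move=> [subW EW] Wu nzu w; have [_ _ irr] := V_irr.
pose Wb : {pred V} := [pred x | `[< W x >]].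
have Wb_sub : lie_submodule (fun=> True) (fun A : 'M[F]_n => rho A : V -> V) Wb.
  split.
    split=> [|c x y /asboolP Wx /asboolP Wy]; apply/asboolP; first exact: subW.1.
    exact: subW.2.
  move=> A x _ /asboolP Wx; apply/asboolP.
  rewrite [A]matrix_sum_delta !linear_sum sum_lfunE; apply: subspace_sum => // i _.
  rewrite linear_sum sum_lfunE; apply: subspace_sum => // k _.
  by rewrite linearZ scale_lfunE; apply: subspaceZ => //; exact: EW.
have [//|W0|Wall] := irr Wb Wb_sub.
  by case/eqP: nzu; apply: W0; apply/asboolP.
exact/asboolP/Wall.
Qed.

Hypotheses (nz_v : v != 0) (wt_v : has_weight glV mu v) (sing_v : singular glV v).

(** The span of the vectors obtained from [v] by lowering operators is stable
    under gl(n). *)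
Lemma lowering_ind (P : V -> Prop) : subspace P -> P v ->
  (forall (a b : 'I_n) u, (b < a)%N -> P u -> P (glV a b u)) -> forall u, P u.
Proof.
move=> subP Pv Plow u.
pose L u := forall Q : V -> Prop, subspace Q -> Q v ->
  (forall (a b : 'I_n) u, (b < a)%N -> Q u -> Q (glV a b u)) -> Q u.
suff: L u by apply.
have subL : subspace L.
  split=> [Q subQ _ _|c x y Lx Ly Q subQ Qv Qlow]; first exact: subQ.1.
  by apply: subQ.2; [apply: Lx | apply: Ly].
have Lv : L v by move=> Q.
have Llow (a b : 'I_n) x : (b < a)%N -> L x -> L (glV a b x).
  by move=> ba Lx Q subQ Qv Qlow; apply: (Qlow) => //; apply: Lx.
apply: (@glV_submodule L v) => //; split=> // a b x Lx.
suff: L x /\ forall a b, L (glV a b x) by case.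
apply: (Lx (fun x => L x /\ forall a b, L (glV a b x))).
- split=> [|c y z [Ly EyL] [Lz EzL]].
    by split; [exact: subL.1 | move=> c d; rewrite linear0; exact: subL.1].
  by split=> [|p q]; [exact: subL.2 | rewrite linearP; exact: subL.2].
- split=> // p q; case: (ltngtP p q) => [pq|qp|/val_inj <-].
  + by rewrite sing_v //; exact: subL.1.
  + exact: Llow.
  by rewrite wt_v; exact: (subspaceZ subL).
move=> p q y qp [Ly ELy]; split; first exact: Llow.
move=> c d; rewrite glV_relations; apply: (subspaceB subL); last exact: (subspaceZ subL).
by apply: (subspaceD subL); [exact: Llow | exact: (subspaceZ subL)].
Qed.

Definition mu_sum : F := \sum_a mu a.

Lemma trace_scalar u : \sum_a glV a a u = mu_sum *: u.
Proof.
move: u; apply: lowering_ind => [|| p q u _ Pu].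
- split=> [|c x y Px Py].
    by rewrite scaler0 big1 // => a _; rewrite linear0.
  rewrite scalerDr scalerA mulrC -scalerA -Px -Py scaler_sumr -big_split.
  by apply: eq_bigr => a _; rewrite linearP.
- by rewrite /mu_sum scaler_suml; apply: eq_bigr => a _; rewrite wt_v.
under eq_bigr do rewrite glV_relations.
rewrite sumrB big_split /= -[X in X + _ - _]linear_sum Pu linearZ /=.
under [X in _ + X - _]eq_bigr do rewrite eq_sym.
rewrite (sum_delta (fun a => glV a q u)).
by rewrite (sum_delta (fun a => glV p a u)) addrK.
Qed.

(** Lowering operators send weight vectors to weight vectors. *)
Lemma weight_spanning : exists us : seq (V * {ffun 'I_n -> F}),
  (forall p, p \in us -> weighted glV p) /\
  (forall P : V -> Prop, subspace P -> (forall p, p \in us -> P p.1) -> forall u, P u).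
Proof.
pose Q u := exists us : seq (V * {ffun 'I_n -> F}),
  (forall p, p \in us -> weighted glV p) /\ u = \sum_(p <- us) p.1.
have Qmap (G : V * {ffun 'I_n -> F} -> V * {ffun 'I_n -> F}) :
    (forall p, weighted glV p -> weighted glV (G p)) ->
    forall us, (forall p, p \in us -> weighted glV p) ->
    forall p, p \in map G us -> weighted glV p.
  by move=> wG us wus p /mapP[q qus ->]; apply: wG; apply: wus.
have Qu u : Q u.
  move: u; apply: lowering_ind.
  - split=> [|c x y [us [wus ->]] [ws [wws ->]]]; first by exists [::]; rewrite big_nil.
    exists (map (fun p => (c *: p.1, p.2)) us ++ ws); split=> [p|].
      rewrite mem_cat => /orP[|/wws//]; move: p; apply: Qmap => // p wp a /=.
      by rewrite linearZ /= wp !scalerA mulrC.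
    by rewrite big_cat big_map /= scaler_sumr.
  - exists [:: (v, finfun mu)]; rewrite big_seq1; split=> // p.
    by rewrite inE => /eqP-> a /=; rewrite ffunE wt_v.
  move=> a b u _ [us [wus ->]].
  pose G (p : V * {ffun 'I_n -> F}) : V * {ffun 'I_n -> F} :=
    (glV a b p.1, [ffun c => p.2 c + ((c == a)%:R - (c == b)%:R)]).
  exists (map G us); split.
    apply: Qmap => // p wp c /=; rewrite ffunE.
    exact: (weight_E glV_relations a b wp).
  by rewrite big_map linear_sum.
pose us k := sval (cid (Qu (vbasis {:V})`_k)).
exists (flatten [seq us k | k <- iota 0 (\dim {:V})]); split=> [p|P subP Pp u].
  case/flattenP => s /mapP[k _ ->]; rewrite /us; case: cid => s' [ws' _] /=.
  exact: ws'.
rewrite (coord_vbasis (memvf u)); apply: subspace_sum => // k _.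
apply: subspaceZ => //; have [_ ->] := svalP (cid (Qu (vbasis {:V})`_k)).
rewrite big_seq; apply: subspace_sum => // p p_us; apply: Pp.
apply/flattenP; exists (us k) => //.
by apply/mapP; exists (nat_of_ord k) => //; rewrite mem_iota /= add0n.
Qed.

Lemma spectral_of_weights (X : lmodType F) (E : 'I_n -> 'I_n -> {linear X -> X})
    (us : seq (X * {ffun 'I_n -> F})) c p :
    (forall p, p \in us -> weighted E p) -> p \in us ->
  spectral (torus E c) (torus_values c us) p.1 = 0.
Proof.
move=> wus p_us; rewrite (spectral_eigen _ (torus_weight c (wus p p_us))).
have in_rs : \sum_a c a * p.2 a \in torus_values c us.
  by rewrite mem_undup; apply/mapP; exists p.
by rewrite (big_rem _ in_rs) /= subrr mul0r scale0r.
Qed.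

Lemma subspace_spectral0 (X : lmodType F) (T : {linear X -> X}) rs :
  subspace (fun x => spectral T rs x = 0).
Proof.
split=> [|c x y x0 y0]; last by rewrite spectral_linear x0 y0 scaler0 addr0.
by have := spectral_linear T rs (-1) 0 0; rewrite scaler0 addr0 scaleN1r addNr.
Qed.

Lemma subspace_null (X : lmodType F) : subspace (fun x : X => x = 0).
Proof. by split=> // c x y -> ->; rewrite scaler0 addr0. Qed.

Lemma gl_stable_null (X : lmodType F) (E : 'I_n -> 'I_n -> {linear X -> X}) :
  gl_stable E (fun x => x = 0).
Proof. by split; [exact: subspace_null | move=> a b x ->; rewrite linear0]. Qed.

Lemma highest_dominance (a b : 'I_n) : (a < b)%N ->
  exists2 m, mu a = mu b + m%:R & iter m.+1 (glV b a) v = 0.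
Proof.
have [us [wus span_us]] := weight_spanning.
have split_all : torus_split glV (fun=> True).
  move=> c; exists (torus_values c us); first exact: undup_uniq.
  move=> x _; move: x; apply: span_us => [|p p_us]; first exact: subspace_spectral0.
  exact: spectral_of_weights.
have stable_all : gl_stable glV (fun=> True) by [].
exact: (dominance charF glV_relations stable_all split_all (gl_stable_null glV) I
  (elimN eqP nz_v) wt_v sing_v).
Qed.

End HighestWeight.

(** * Commutation rules on polynomial tensors *)

Section LinearMaps.
Variables (F : fieldType) (X Y Z : lmodType F).

Lemma lin_comp (f : Y -> Z) (g : X -> Y) : linear f -> linear g ->
  linear (fun x => f (g x)).
Proof. by move=> lf lg c x y; rewrite lg lf. Qed.

Lemma lin_add (f g : X -> Y) : linear f -> linear g -> linear (fun x => f x + g x).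
Proof. by move=> lf lg c x y; rewrite lf lg scalerDr addrACA. Qed.

Lemma lin_sub (f g : X -> Y) : linear f -> linear g -> linear (fun x => f x - g x).
Proof.
by move=> lf lg c x y; rewrite lf lg scalerBr opprD addrACA.
Qed.

Lemma lin_scale k (f : X -> Y) : linear f -> linear (fun x => k *: f x).
Proof. by move=> lf c x y; rewrite lf scalerDr !scalerA mulrC. Qed.

Lemma lin_sum (I : Type) (r : seq I) (f : I -> X -> Y) : (forall i, linear (f i)) ->
  linear (fun x => \sum_(i <- r) f i x).
Proof.
move=> lf c x y; rewrite scaler_sumr -big_split; apply: eq_bigr => i _.
exact: lf.
Qed.

Lemma lin_eq (f g : X -> Y) : linear f -> linear g -> subspace (fun x => f x = g x).
Proof.
move=> lf lg; split=> [|c x y fx fy]; first by rewrite !linear_zero.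
by rewrite lf lg fx fy.
Qed.

End LinearMaps.

Lemma addr_shuffle (G : zmodType) (a b c d e f g h : G) :
  a + b + c + d + (e + (f + g + h)) = a + e + (d + f) + (b + g) + (c + h).
Proof. by rewrite (AC (4*(1*3)) ((1*5)*(4*6)*(2*7)*(3*8)))%AC. Qed.

Section TensorOperators.
Variables (F : fieldType) (charF : [pchar F] =i pred0) (n : nat).
Variables (V : vectType F) (rho : {linear 'M[F]_n -> 'End(V)}).
Hypotheses (V_rep : gl_representation rho).
Local Notation A := {mpoly F[n]}.
Local Notation M := {ffun 'I_(\dim {:V}) -> A}.
Local Notation E := (glV rho).

Fact op_key : unit. Proof. exact: tt. Qed.
Definition opE : 'I_n -> 'I_n -> {linear M -> M} :=
  locked_with op_key (fun a b => vf_act rho (vf_xpartial F a b) : {linear M -> M}).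
Definition opD : 'I_n -> {linear M -> M} :=
  locked_with op_key (fun j => vf_act rho (vf_partial F j) : {linear M -> M}).
Definition opP : 'I_n -> {linear M -> M} :=
  locked_with op_key (fun i => vf_act rho (vf_p F i) : {linear M -> M}).
Definition opX : 'I_n -> {linear M -> M} := 
  locked_with op_key (fun c => mulX c : {linear M -> M}).

Lemma opE_act a b m : opE a b m = vf_act rho (vf_xpartial F a b) m.
Proof. by rewrite /opE unlock. Qed.

Lemma opD_act j m : opD j m = vf_act rho (vf_partial F j) m.
Proof. by rewrite /opD unlock. Qed.

Lemma opP_act i m : opP i m = vf_act rho (vf_p F i) m.
Proof. by rewrite /opP unlock. Qed.

Lemma opX_pure c (f : A) u : opX c (pure_tensor f u) = pure_tensor ('X_c * f) u.
Proof. by rewrite /opX unlock /= mulX_pure. Qed.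

Lemma opE_pure a b (f : A) u : opE a b (pure_tensor f u) =
  pure_tensor ('X_a * mderiv b f) u + pure_tensor f (E a b u).
Proof. by rewrite opE_act vf_act_xpartial. Qed.

Lemma opD_pure j (f : A) u : opD j (pure_tensor f u) = pure_tensor (mderiv j f) u.
Proof. by rewrite opD_act vf_act_partial. Qed.

Lemma mderiv_mulX c a (f : A) :
  mderiv c ('X_a * f) = (c == a)%:R *: f + 'X_a * mderiv c f.
Proof. by rewrite mderivM mderiv_var eq_sym scaler_nat mulr_natl. Qed.

Let D_comm a b c d (f : A) : 'X_a * mderiv b ('X_c * mderiv d f) =
  'X_c * mderiv d ('X_a * mderiv b f) + (b == c)%:R *: ('X_a * mderiv d f)
    - (d == a)%:R *: ('X_c * mderiv b f).
Proof.
rewrite !mderiv_mulX !scaler_nat !(mderiv_comm d b).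
by rewrite !mulrDr !mulrnAr; ring.
Qed.

Lemma opE_relations : gl_relations opE.
Proof.
move=> a b c d; apply: tensor_ind => [|f u].
  apply: (lin_eq (lin_comp (linearP (opE a b)) (linearP (opE c d)))).
  apply: lin_sub (lin_scale _ (linearP (opE c b))).
  apply: lin_add (lin_scale _ (linearP (opE a d))).
  exact: lin_comp (linearP (opE c d)) (linearP (opE a b)).
rewrite !opE_pure !linearD /= !opE_pure D_comm glV_relations //.
rewrite !pure_tensorDl !pure_tensorDr -!scaleNr !pure_tensorZl !pure_tensorZr.
exact: addr_shuffle.
Qed.

Lemma opE_opX a b c m :
  opE a b (opX c m) = opX c (opE a b m) + (b == c)%:R *: opX a m.
Proof.
move: m; apply: tensor_ind => [|f u].
  apply: lin_eq (lin_comp (linearP (opE a b)) (linearP (opX c))) _.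
  apply: lin_add (lin_scale _ (linearP (opX a))).
  exact: lin_comp (linearP (opX c)) (linearP (opE a b)).
rewrite opX_pure !opE_pure mderiv_mulX [opX c (_ + _)]linearD /= !opX_pure.
rewrite mulrDr -scalerAr pure_tensorDl pure_tensorZl mulrCA.
by rewrite -[LHS]addrA addrC.
Qed.

Lemma opD_opX c a m : opD c (opX a m) = opX a (opD c m) + (c == a)%:R *: m.
Proof.
move: m; apply: tensor_ind => [|f u].
  apply: lin_eq (lin_comp (linearP (opD c)) (linearP (opX a))) _.
  apply: lin_add (lin_scale _ (linearP idfun)).
  exact: lin_comp (linearP (opX a)) (linearP (opD c)).
rewrite opX_pure !opD_pure mderiv_mulX opX_pure.
by rewrite pure_tensorDl pure_tensorZl addrC.
Qed.

Lemma opD_opE a b c m :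
  opD c (opE a b m) = opE a b (opD c m) + (c == a)%:R *: opD b m.
Proof.
move: m; apply: tensor_ind => [|f u].
  apply: lin_eq (lin_comp (linearP (opD c)) (linearP (opE a b))) _.
  apply: lin_add (lin_scale _ (linearP (opD b))).
  exact: lin_comp (linearP (opE a b)) (linearP (opD c)).
rewrite opE_pure [opD c (_ + _)]linearD /= !opD_pure opE_pure mderiv_mulX mderiv_comm.
by rewrite pure_tensorDl pure_tensorZl addrC addrA addrAC [X in X + _]addrC.
Qed.

Section ScalarTrace.
Variable tr : F.
Hypothesis trE : forall u, \sum_a E a a u = tr *: u.

(** Written through the total action of gl(n), p_i inherits its commutation
    rules from those of the multiplications by the x_r. *)
Lemma opP_opX i m : opP i m = \sum_r opX r (opE i r m) + tr *: opX i m.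
Proof.
move: m; apply: tensor_ind => [|f u].
  apply: lin_eq; first exact: linearP.
  apply: lin_add (lin_scale _ (linearP (opX i))).
  by apply: lin_sum => r; exact: lin_comp (linearP (opX r)) (linearP (opE i r)).
rewrite opP_act vf_act_p opX_pure -pure_tensorZr -trE.
rewrite mulr_sumr pure_tensor_suml addrAC -big_split /=; congr (_ + _).
apply: eq_bigr => r _; rewrite opE_pure [opX r (_ + _)]linearD /= !opX_pure.
by rewrite mulrCA.
Qed.

Lemma opE_opP a b c m : opE a b (opP c m) = opP c (opE a b m) + (b == c)%:R *: opP a m.
Proof.
rewrite !opP_opX [opE a b (_ + _)]linearD [opE a b (tr *: _)]linearZ.
rewrite [opE a b (\sum_(_ <- _) _)]linear_sum /= opE_opX.
pose G r := (b == c)%:R *: opX r (opE a r m).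
pose H r := (b == r)%:R *: opX a (opE c r m).
pose K r := (r == a)%:R *: opX r (opE c b m).
have termE r : opE a b (opX r (opE c r m)) =
    opX r (opE c r (opE a b m)) + G r - K r + H r.
  by rewrite opE_opX opE_relations [opX r (_ - _)]linearB [opX r (_ + _)]linearD
      ![opX r (_ *: _)]linearZ.
rewrite (eq_bigr _ (fun r _ => termE r)) !big_split sumrN /=.
have -> : \sum_r H r = opX a (opE c b m) by exact: sum_delta.
have -> : \sum_r K r = opX a (opE c b m).
  rewrite -[RHS](sum_delta (fun r => opX r (opE c b m))).
  by apply: eq_bigr => r _; rewrite eq_sym.
rewrite subrK /G -scaler_sumr.
move: (\sum_r _) (\sum_r _) (opX c _) (opX a m) => x y z t.
by rewrite !scalerDr !scalerA [tr * _]mulrC addrACA.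
Qed.

Lemma opD_opP j i m : opD j (opP i m) = opP i (opD j m) + opE i j m
  + (j == i)%:R *: (\sum_r opE r r m).
Proof.
have EulerE : \sum_r opE r r m = \sum_r opX r (opD r m) + tr *: m.
  move: m; apply: tensor_ind => [|f u].
    apply: lin_eq; first by apply: lin_sum => r; exact: linearP.
    apply: lin_add (lin_scale _ (linearP idfun)).
    by apply: lin_sum => r; exact: lin_comp (linearP (opX r)) (linearP (opD r)).
  rewrite -pure_tensorZr -trE pure_tensor_sumr -big_split /=.
  by apply: eq_bigr => r _; rewrite opE_pure opD_pure opX_pure.
rewrite EulerE !opP_opX [opD j (_ + _)]linearD [opD j (tr *: _)]linearZ.
rewrite [opD j (\sum_(_ <- _) _)]linear_sum /= opD_opX.
pose G r := (j == i)%:R *: opX r (opD r m).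
pose H r := (j == r)%:R *: opE i r m.
have termE r : opD j (opX r (opE i r m)) = opX r (opE i r (opD j m)) + G r + H r.
  by rewrite opD_opX opD_opE [opX r (_ + _)]linearD [opX r (_ *: _)]linearZ.
rewrite (eq_bigr _ (fun r _ => termE r)) !big_split /=.
have -> : \sum_r H r = opE i j m by exact: (sum_delta (fun r => opE i r m)).
rewrite /G -scaler_sumr.
move: (\sum_r _) (\sum_r _) (opX i _) (opE i j m) => x y z t.
by rewrite !scalerDr !scalerA [tr * _]mulrC (AC (3*2) (1*4*3*(2*5)))%AC.
Qed.

End ScalarTrace.
End TensorOperators.

(** * Linear functionals *)

Section Dual.
Variables (F : fieldType) (M : lmodType F).

Record dual := Dual { dual_fun :> M -> F; dual_linear : linear (dual_fun : M -> F^o) }.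
Implicit Types (phi psi : dual).

HB.instance Definition _ phi :=
  GRing.isLinear.Build F M F^o _ (dual_fun phi : M -> F^o) (dual_linear phi).

Lemma dualP phi psi : (forall m, phi m = psi m) -> phi = psi.
Proof.
case: phi psi => [f lf] [g lg] /= fg; have {fg}fg : f = g by apply: funext.
by subst g; congr Dual; apply: Prop_irrelevance.
Qed.

Lemma dual_lin phi c x y : phi (c *: x + y) = c * phi x + phi y.
Proof. exact: dual_linear. Qed.

Lemma dual0 phi : phi 0 = 0.
Proof. by have := dual_lin phi (-1) 0 0; rewrite scaler0 addr0 mulN1r addNr. Qed.

Lemma dualD phi x y : phi (x + y) = phi x + phi y.
Proof. by have := dual_lin phi 1 x y; rewrite scale1r mul1r. Qed.

Lemma dualZ phi c x : phi (c *: x) = c * phi x.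
Proof. by have := dual_lin phi c x 0; rewrite !addr0 dual0 addr0. Qed.

Lemma dualN phi x : phi (- x) = - phi x.
Proof. by rewrite -scaleN1r dualZ mulN1r. Qed.

Lemma dualB phi x y : phi (x - y) = phi x - phi y.
Proof. by rewrite dualD dualN. Qed.

Lemma dual_sum phi (I : Type) (r : seq I) (P : pred I) (G : I -> M) :
  phi (\sum_(i <- r | P i) G i) = \sum_(i <- r | P i) phi (G i).
Proof. exact: (big_morph phi (dualD phi) (dual0 phi)). Qed.

HB.instance Definition _ := gen_eqMixin dual.
HB.instance Definition _ := gen_choiceMixin dual.

Fact dual_zero_linear : linear ((fun=> 0) : M -> F^o).
Proof. by move=> c x y; rewrite scaler0 addr0. Qed.
Fact dual_opp_linear phi : linear ((fun m => - phi m) : M -> F^o).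
Proof. by move=> c x y; rewrite /= dual_lin opprD -mulrN. Qed.
Fact dual_add_linear phi psi : linear ((fun m => phi m + psi m) : M -> F^o).
Proof. by move=> c x y; rewrite /= !dual_lin -[RHS]/(_ * _ + _) mulrDr addrACA. Qed.
Fact dual_scale_linear a phi : linear ((fun m => a * phi m) : M -> F^o).
Proof.
by move=> c x y; rewrite /= !dual_lin -[RHS]/(_ * _ + _) mulrDr mulrCA.
Qed.

Let dzero := Dual dual_zero_linear.
Let dopp phi := Dual (dual_opp_linear phi).
Let dadd phi psi := Dual (dual_add_linear phi psi).

Fact dual_addA : associative dadd.
Proof. by move=> f g h; apply: dualP => m /=; rewrite addrA. Qed.
Fact dual_addC : commutative dadd.
Proof. by move=> f g; apply: dualP => m /=; rewrite addrC. Qed.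
Fact dual_add0 : left_id dzero dadd.
Proof. by move=> f; apply: dualP => m /=; rewrite add0r. Qed.
Fact dual_addN : left_inverse dzero dopp dadd.
Proof. by move=> f; apply: dualP => m /=; rewrite addNr. Qed.
HB.instance Definition _ := GRing.isZmodule.Build dual
  dual_addA dual_addC dual_add0 dual_addN.

Let dscale a phi := Dual (dual_scale_linear a phi).
Fact dual_scaleA a b phi : dscale a (dscale b phi) = dscale (a * b) phi.
Proof. by apply: dualP => m /=; rewrite mulrA. Qed.
Fact dual_scale1 : left_id 1 dscale.
Proof. by move=> phi; apply: dualP => m /=; rewrite mul1r. Qed.
Fact dual_scaleDr : right_distributive dscale +%R.
Proof. by move=> a f g; apply: dualP => m /=; rewrite mulrDr. Qed.
Fact dual_scaleDl phi : {morph dscale^~ phi : a b / a + b}.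
Proof. by move=> a b; apply: dualP => m /=; rewrite mulrDl. Qed.
HB.instance Definition _ := GRing.Zmodule_isLmodule.Build F dual
  dual_scaleA dual_scale1 dual_scaleDr dual_scaleDl.

Lemma dual_addE phi psi m : (phi + psi) m = phi m + psi m. Proof. by []. Qed.
Lemma dual_oppE phi m : (- phi) m = - phi m. Proof. by []. Qed.
Lemma dual_zeroE m : (0 : dual) m = 0. Proof. by []. Qed.
Lemma dual_scaleE a phi m : (a *: phi) m = a * phi m. Proof. by []. Qed.

Lemma dual_sumE (I : Type) (r : seq I) (P : pred I) (G : I -> dual) m :
  (\sum_(i <- r | P i) G i) m = \sum_(i <- r | P i) G i m.
Proof. exact: (big_morph (fun phi : dual => phi m)). Qed.

Fact transpose_linear_subproof (T : {linear M -> M}) phi :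
  linear ((fun m => phi (T m)) : M -> F^o).
Proof. by move=> c x y; rewrite linearP /= dual_lin. Qed.

Definition transpose (T : {linear M -> M}) (phi : dual) : dual :=
  Dual (transpose_linear_subproof T phi).

Lemma transpose_linear T : linear (transpose T).
Proof. by move=> c f g; apply: dualP. Qed.
HB.instance Definition _ T := GRing.isLinear.Build F dual dual _ (transpose T)
  (transpose_linear T).

Definition kills (W : M -> Prop) phi : Prop := forall m, W m -> phi m = 0.

Lemma subspace_kills W : subspace (kills W).
Proof.
split=> [//|c f g f0 g0 m Wm].
by rewrite dual_addE dual_scaleE f0 // g0 // mulr0 addr0.
Qed.

Lemma subspace_kernel phi : subspace (fun m => phi m = 0).
Proof. by split=> [|c x y x0 y0]; rewrite ?dual0 // dual_lin x0 y0 mulr0 addr0. Qed.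

End Dual.

(** A matrix of maximal rank with rows in [P] has row space [P]; a column of its
    cokernel separates [w] from it. *)
Lemma row_separation (F : fieldType) N (P : 'rV[F]_N -> Prop) w : subspace P -> ~ P w ->
  exists phi : 'cV[F]_N, (forall u, P u -> u *m phi = 0) /\ w *m phi != 0.
Proof.
move=> subP nPw; pose R (k : nat) := `[< exists B : 'M[F]_N,
  (forall i, P (row i B)) /\ \rank B = k >].
have exR : exists k, R k.
  exists 0%N; apply/asboolP; exists 0; split; last exact: mxrank0.
  by move=> i; rewrite row0; exact: subP.1.
have ubR k : R k -> (k <= N)%N by case/asboolP => B [_ <-]; exact: rank_leq_row.
case: (ex_maxnP exR ubR) => k /asboolP[B [PB rankB]] maxk.
have spanP u : (u <= B)%MS -> P u.
  move/submxP => [D ->]; rewrite mulmx_sum_row; apply: (subspace_sum subP) => i _.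
  exact: (subspaceZ subP).
have subB u : P u -> (u <= B)%MS.
  move=> Pu; apply: contraT => nuB.
  have Prow i : P (row i (B + u)%MS).
    have /sub_addsmxP[[D1 D2] /= ->] : (row i (B + u)%MS <= B + u)%MS by exact: row_sub.
    apply: (subspaceD subP); first by apply: spanP; exact: submxMl.
    by rewrite [D2]mx11_scalar mul_scalar_mx; apply: (subspaceZ subP).
  have /maxk : R (\rank (B + u)%MS) by apply/asboolP; exists (B + u)%MS.
  rewrite -rankB leqNgt ltn_neqAle; case/negP; rewrite mxrankS ?addsmxSl // andbT.
  apply: contra nuB => /eqP eq_rank.
  have : (B + u <= B)%MS by rewrite -(geq_leqif (mxrank_leqif_sup (addsmxSl B u))) -eq_rank.
  by rewrite addsmx_sub => /andP[].
have nwB : w *m cokermx B != 0.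
  by apply/negP => /eqP wB; apply: nPw; apply: spanP; rewrite submxE wB.
have [j nz_j] : exists j, (w *m cokermx B) 0 j != 0.
  apply: contrapT => no; case/eqP: nwB; apply/rowP => j; rewrite [RHS]mxE.
  by apply/eqP; apply: contrapT => /negP ?; apply: no; exists j.
exists (col j (cokermx B)); split=> [u /subB|].
  by rewrite submxE => /eqP uB; rewrite colE mulmxA uB mul0mx.
rewrite colE mulmxA -colE; apply/negP => /eqP/(congr1 (fun D : 'cV[F]_1 => D 0 0)).
by rewrite !mxE => /eqP; rewrite mxE in nz_j; exact/negP.
Qed.

(** * Singular functionals on polynomial tensors *)

Section TensorFunctionals.
Variables (F : fieldType) (charF : [pchar F] =i pred0) (n : nat).
Variables (V : vectType F) (rho : {linear 'M[F]_n -> 'End(V)}).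
Hypotheses (V_rep : gl_representation rho) (V_irr : gl_irreducible rho).
Variables (mu : 'I_n -> F) (v : V).
Local Notation A := {mpoly F[n]}.
Local Notation M := {ffun 'I_(\dim {:V}) -> A}.
Local Notation E := (glV rho).
Local Notation opE := (opE rho).
Local Notation opD := (opD rho).
Local Notation opP := (opP rho).
Hypotheses (nz_v : v != 0) (wt_v : has_weight E mu v) (sing_v : singular E v).
Implicit Types (psi : dual M) (al be : 'X_{1..n}) (u : V).

Let natF0 m : (m%:R == 0 :> F) = (m == 0)%N.
Proof. by move/pcharf0P: charF => ->. Qed.

Let natF_inj (p q : nat) : p%:R = q%:R :> F -> p = q.
Proof.
wlog le_pq : p q / (p <= q)%N.
  by move=> H e; case/orP: (leq_total p q) => h; [exact: H | symmetry; exact: H].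
move=> e; have /eqP : (q - p)%:R = 0 :> F by rewrite natrB // e subrr.
by rewrite natF0 subn_eq0 => qp; apply/eqP; rewrite eqn_leq le_pq qp.
Qed.

(** Transposing the indices as well makes the dual a gl(n)-module in which
    singular vectors and weights have their usual form. *)
Definition Ed (a b : 'I_n) : {linear dual M -> dual M} := transpose (opE b a).
Definition Xd (c : 'I_n) : {linear dual M -> dual M} := transpose (opD c).
Definition Pd (l : 'I_n) : {linear dual M -> dual M} := transpose (opP l).

Lemma EdE a b psi m : Ed a b psi m = psi (opE b a m). Proof. by []. Qed.
Lemma XdE c psi m : Xd c psi m = psi (opD c m). Proof. by []. Qed.
Lemma PdE l psi m : Pd l psi m = psi (opP l m). Proof. by []. Qed.

Lemma Ed_relations : gl_relations Ed.
Proof.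
move=> a b c d psi; apply: dualP => m.
rewrite EdE EdE dual_addE dual_addE dual_oppE !dual_scaleE !EdE.
rewrite opE_relations // dualB dualD !dualZ.
by rewrite [c == b]eq_sym [a == d]eq_sym.
Qed.

Lemma Ed_Xd a b c psi : Ed a b (Xd c psi) = Xd c (Ed a b psi) + (b == c)%:R *: Xd a psi.
Proof.
apply: dualP => m; rewrite dual_addE dual_scaleE EdE !XdE EdE.
by rewrite opD_opE dualD dualZ eq_sym.
Qed.

Lemma Ed_Pd a b l psi : Ed a b (Pd l psi) = Pd l (Ed a b psi) - (a == l)%:R *: Pd b psi.
Proof.
apply: dualP => m; rewrite dual_addE dual_oppE dual_scaleE EdE !PdE EdE.
by rewrite (opE_opP V_rep (trace_scalar V_rep V_irr nz_v wt_v sing_v)) dualD dualZ addrK.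
Qed.

Local Notation xv al := (pure_tensor 'X_[al] v : M).

Lemma mulX_mderivX a b al : 'X_a * mderiv b 'X_[al] =
  (al b)%:R *: 'X_[al - U_(b) + U_(a)] :> A.
Proof. by rewrite mderivX -scalerAr mpolyXD mulrC. Qed.

Lemma mulX_mderiv_diag a al : 'X_a * mderiv a 'X_[al] = (al a)%:R *: 'X_[al] :> A.
Proof.
rewrite mulX_mderivX; have [->|nz] := eqVneq (al a) 0%N; first by rewrite !scale0r.
by rewrite submK // lep1mP.
Qed.

Lemma mulX_mderiv_add a c al : 'X_a * mderiv c 'X_[al + U_(c)] =
  (al c).+1%:R *: 'X_[al + U_(a)] :> A.
Proof. by rewrite mulX_mderivX addmK mnmDE mnm1E eqxx addn1. Qed.

Lemma pure_weight al u lam : has_weight E lam u ->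
  has_weight opE (fun a => (al a)%:R + lam a) (pure_tensor 'X_[al] u : M).
Proof.
move=> wu a; rewrite opE_pure mulX_mderiv_diag wu pure_tensorZl pure_tensorZr.
by rewrite -scalerDl.
Qed.

Lemma eval_weight psi lam al u nu : has_weight Ed lam psi -> has_weight E nu u ->
  psi (pure_tensor 'X_[al] u) != 0 -> forall a, lam a = nu a + (al a)%:R.
Proof.
move=> wpsi wu nz a; have := congr1 (fun f : dual M => f (pure_tensor 'X_[al] u)) (wpsi a).
rewrite EdE (pure_weight al wu) dualZ dual_scaleE => /(mulIf nz) <-.
by rewrite addrC.
Qed.

Lemma singular_lower psi (a b : 'I_n) (f : A) u : singular Ed psi -> (b < a)%N ->
  psi (pure_tensor f (E a b u)) = - psi (pure_tensor ('X_a * mderiv b f) u).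
Proof.
move=> spsi ba; have := congr1 (fun g : dual M => g (pure_tensor f u)) (spsi b a ba).
by rewrite EdE opE_pure dualD dual_zeroE => /eqP; rewrite addrC addr_eq0 => /eqP.
Qed.

(** As V is spanned by vectors lowered from v, and a singular functional moves
    lowering operators from V to the polynomials, its values on A (x) v
    determine it. *)
Lemma singular_eq0 psi : singular Ed psi -> (forall al, psi (xv al) = 0) -> psi = 0.
Proof.
move=> spsi psi0; have psiV u (f : A) : psi (pure_tensor f u) = 0.
  move: u f; apply: (lowering_ind V_rep V_irr nz_v wt_v sing_v) => [||a b u ba IH f].
  - split=> /= [f|c x y x0 y0 f]; first by rewrite pure_tensor0r dual0.
    by rewrite pure_tensorDr pure_tensorZr dual_lin x0 y0 mulr0 addr0.
  - move=> f; rewrite [f]mpolyE pure_tensor_suml dual_sum big1 // => be _.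
    by rewrite pure_tensorZl dualZ psi0 mulr0.
  by rewrite singular_lower // IH oppr0.
apply: dualP => m; rewrite dual_zeroE; move: m.
by apply: tensor_ind => [|f u]; [exact: subspace_kernel | exact: psiV].
Qed.

(** These are the functionals psi_al; every nonzero singular weight functional
    is one of them, see [singular_row_weight]. *)
Definition row_weight al (psi : dual M) : Prop :=
  [/\ singular Ed psi, has_weight Ed (fun a => mu a + (al a)%:R) psi & psi (xv al) != 0].

Lemma singular_row_weight psi lam : singular Ed psi -> has_weight Ed lam psi ->
  psi != 0 -> exists2 al, row_weight al psi & forall a, lam a = mu a + (al a)%:R.
Proof.
move=> spsi wpsi nz; have [[al nz_al]|none] := pselect (exists al, psi (xv al) != 0).
  have lamE := eval_weight wpsi wt_v nz_al.
  by exists al => //; split=> // a; rewrite wpsi lamE.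
case/eqP: nz; apply: singular_eq0 => // al; apply/eqP; apply: contrapT => /negP nz_al.
by apply: none; exists al.
Qed.

Lemma row_weight_eval0 al be psi : row_weight al psi -> al != be -> psi (xv be) = 0.
Proof.
move=> [spsi wpsi nz] neq; apply/eqP; apply: contraT => nz_be.
case/eqP: neq; apply/mnmP => a; apply: natF_inj; apply: (addrI (mu a)).
exact: (eval_weight wpsi wt_v nz_be a).
Qed.

Lemma row_weight_proportional al psi phi : row_weight al psi -> row_weight al phi ->
  psi = (psi (xv al) / phi (xv al)) *: phi.
Proof.
move=> rpsi rphi; apply/eqP; rewrite -subr_eq0; apply/eqP; apply: singular_eq0.
  case: rpsi rphi => [spsi _ _] [sphi _ _] a b ab.
  by rewrite linearB linearZ /= spsi // sphi // scaler0 subr0.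
move=> be; rewrite dual_addE dual_oppE dual_scaleE.
have [<-|neq] := eqVneq al be; last first.
  by rewrite (row_weight_eval0 rpsi neq) (row_weight_eval0 rphi neq) mulr0 subrr.
by rewrite divfK ?subrr //; case: rphi.
Qed.

Let iter_shift a b r be : a != b -> exists2 c : F, c != 0 &
  iter r (fun f : A => 'X_b * mderiv a f) 'X_[be + U_(a) *+ r]
    = c *: 'X_[be + U_(b) *+ r].
Proof.
move=> neq; elim: r be => [|r IH] be.
  by exists 1; rewrite ?oner_eq0 // scale1r !mulm0n !addm0.
have [c nz_c cE] := IH (be + U_(b))%MM.
exists ((be a + r).+1%:R * c); first by rewrite mulf_neq0 // natF0.
rewrite iterSr mulmSr addmA mulX_mderiv_add mnmDE mulmnE mnm1E eqxx mul1n.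
have iterZ k (f : A) : iter r (fun f : A => 'X_b * mderiv a f) (k *: f) =
    k *: iter r (fun f : A => 'X_b * mderiv a f) f.
  by elim: r {IH cE} => //= r ->; rewrite mderivZ scalerAr.
rewrite iterZ -addmA [(_ *+ r + _)%MM]addmC addmA cE scalerA.
by congr (_ *: 'X_[_]); rewrite -addmA -mulmS.
Qed.

(** As E_ba^(m+1) kills v, the functional kills E_ba^(m+1)(x^be) (x) v, so that
    al is a horizontal strip added to mu. *)
Lemma row_weight_strip al psi (a b : 'I_n) m : row_weight al psi -> (a < b)%N ->
  mu a = mu b + m%:R -> (al b <= m)%N.
Proof.
move=> [spsi wpsi nz] ab mu_m; rewrite leqNgt; apply/negP => lt_m.
have neq : a != b by apply: contraTneq ab => ->; rewrite ltnn.
have [m' mu_m' killed] := highest_dominance charF V_rep V_irr nz_v wt_v sing_v ab.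
have em : m' = m.
  by apply: natF_inj; apply: (addrI (mu b)); rewrite -mu_m -mu_m'.
rewrite {}em in killed; pose be := (al - U_(b) *+ m.+1)%MM.
have alE : (be + U_(b) *+ m.+1)%MM = al.
  apply/mnmP => c; rewrite mnmDE mnmBE mulmnE mnm1E.
  by case: eqP => [<-|_]; rewrite ?mul0n ?mul1n ?subn0 ?addn0 // subnK.
have [c nz_c] := iter_shift m.+1 be neq; rewrite alE => cE.
have lowerE r (f : A) : psi (pure_tensor f (iter r (E b a) v)) =
    (-1) ^+ r * psi (pure_tensor (iter r (fun f : A => 'X_b * mderiv a f) f) v).
  elim: r f => [|r IH] f; first by rewrite mul1r.
  by rewrite iterS singular_lower // IH exprS mulN1r mulNr iterSr.
have := lowerE m.+1 'X_[be + U_(a) *+ m.+1].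
rewrite killed pure_tensor0r dual0 cE pure_tensorZl dualZ => /esym/eqP.
by rewrite !mulf_eq0 signr_eq0 (negPf nz_c) (negPf nz).
Qed.

(** The content of the box that follows [s] boxes in row [l]; rows are numbered
    from 0, and p_l adds this box with its content as factor. *)
Definition content (l : 'I_n) (s : nat) : F := mu_sum mu + mu l + s%:R - l%:R.

Lemma eval_opP psi l al : singular Ed psi -> psi (opP l (xv al)) =
  (content l (al l) + \sum_(i < n | (l < i)%N) (al i)%:R) * psi (xv (al + U_(l))).
Proof.
move=> spsi; rewrite opP_act vf_act_p 2!dualD dual_sum.
pose t := psi (xv (al + U_(l))).
have XE i : 'X_i * 'X_[al] = 'X_[al + U_(i)] :> A by rewrite mpolyXD mulrC.
have -> : 'X_l * (\sum_r 'X_r * mderiv r 'X_[al]) =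
    (\sum_r (al r)%:R) *: 'X_[al + U_(l)] :> A.
  rewrite (eq_bigr (fun r => (al r)%:R *: ('X_[al] : A))) => [|r _].
    by rewrite -scaler_suml -scalerAr XE.
  exact: mulX_mderiv_diag.
rewrite (trace_scalar V_rep V_irr nz_v wt_v sing_v) XE pure_tensorZl pure_tensorZr.
rewrite !dualZ -/t.
have termE j : psi (pure_tensor ('X_j * 'X_[al]) (rho (delta_mx l j) v)) =
    (if j == l then mu l else if (j < l)%N then - (al j).+1%:R else 0) * t.
  rewrite -[rho _ v]/(E l j v).
  case: (ltngtP j l) => [jl|lj|/val_inj->].
  - rewrite -(inj_eq val_inj) /= ltn_eqF // singular_lower // XE mulX_mderiv_add.
    by rewrite pure_tensorZl dualZ mulNr.
  - by rewrite -(inj_eq val_inj) /= gtn_eqF // sing_v // pure_tensor0r dual0 mul0r.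
  by rewrite eqxx wt_v pure_tensorZr dualZ XE.
rewrite (eq_bigr _ (fun j _ => termE j)) -mulr_suml -!mulrDl; congr (_ * _).
have sum3 (G : 'I_n -> F) : \sum_i G i =
    G l + (\sum_(i < n | (i < l)%N) G i + \sum_(i < n | (l < i)%N) G i).
  rewrite (bigD1 l) //= (bigID (fun j : 'I_n => j < l)%N) /=; congr (_ + (_ + _)).
    by apply: eq_bigl => i; rewrite -(inj_eq val_inj) /=; lia.
  by apply: eq_bigl => i; rewrite -(inj_eq val_inj) /=; lia.
rewrite !sum3 eqxx.
rewrite [X in _ + (_ + (_ + X))]big1 => [|j lj]; last first.
  by rewrite -(inj_eq val_inj) /= gtn_eqF // ltnNge ltnW.
rewrite [X in _ + (_ + (X + _))](eq_bigr (fun j : 'I_n => - (al j)%:R - 1)) => [|j jl].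
  rewrite sumrB sumrN (_ : \sum_(j < n | (j < l)%N) 1 = l%:R :> F).
    by rewrite /content; ring.
  rewrite sumr_const -sum1_card; congr (_%:R).
  have n0 : (0 < n)%N := leq_ltn_trans (leq0n l) (ltn_ord l).
  by rewrite -[RHS]subn0 -(@card_ord_interval n (Ordinal n0) l).
by rewrite -(inj_eq val_inj) /= ltn_eqF // jl -addn1 natrD opprD.
Qed.

Lemma Pd_singular al psi (l : 'I_n) : row_weight al psi ->
    (forall i : 'I_n, (l < i)%N -> Pd i psi = 0) ->
  singular Ed (Pd l psi) /\
  has_weight Ed (fun a => mu a + (al a)%:R - (a == l)%:R) (Pd l psi).
Proof.
move=> [spsi wpsi nz] Pd0; split=> [a b ab|a]; rewrite Ed_Pd.
  rewrite spsi // linear0 sub0r; case: eqP => [al_l|_]; last by rewrite scale0r oppr0.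
  by rewrite Pd0 ?scaler0 ?oppr0 // -al_l.
rewrite wpsi linearZ /= scalerBl; congr (_ - _).
by case: eqP => [->|_]; rewrite ?scale0r.
Qed.

Lemma Pd_empty_row al psi (l : 'I_n) : row_weight al psi ->
  (forall i : 'I_n, (l < i)%N -> Pd i psi = 0) -> al l = 0%N -> Pd l psi = 0.
Proof.
move=> rpsi Pd0 al0; apply/eqP; apply: contraT => nz.
have [sP wP] := Pd_singular rpsi Pd0.
have [be _ /(_ l)] := singular_row_weight sP wP nz.
rewrite al0 // eqxx addr0 => /addrI/eqP; rewrite eq_sym -addr_eq0.
by rewrite natr1 natF0.
Qed.

Lemma Pd_above al psi (j : 'I_n) : row_weight al psi ->
  (forall i : 'I_n, (j < i)%N -> al i = 0%N) ->
  forall i : 'I_n, (j < i)%N -> Pd i psi = 0.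
Proof.
move=> rpsi al0 i; have [k] := ubnP (n - i)%N; elim: k i => // k IH i.
rewrite ltnS => ik ji; apply: (Pd_empty_row rpsi) => [i' ii'|]; last exact: al0.
apply: IH; last exact: ltn_trans ii'.
by apply: leq_trans ik; rewrite ltn_sub2l.
Qed.

(** The transposes of the p_i with i > j vanish on [psi], since al - eps_i is
    not in N^n; hence that of p_j preserves singularity, and its value is the
    content of the removed box. *)
Lemma row_removal al psi (j : 'I_n) : row_weight al psi ->
    (forall i : 'I_n, (j < i)%N -> al i = 0%N) -> (0 < al j)%N ->
    content j (al j).-1 != 0 ->
  row_weight (al - U_(j))%MM (Pd j psi).
Proof.
move=> rpsi al0 al_j nz; have Pd0 := Pd_above rpsi al0.
have [sP wP] := Pd_singular rpsi Pd0; split=> // [a|].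
  rewrite wP; congr (_ *: _); rewrite -addrA mnmBE mnm1E [j == a]eq_sym.
  by case: eqP => [->|_]; rewrite ?natrB ?subn0 ?subr0.
have alE : (al - U_(j) + U_(j))%MM = al by rewrite submK // lep1mP -lt0n.
case: rpsi => spsi _ nzpsi; rewrite PdE eval_opP // alE mulf_neq0 //.
rewrite big1 ?addr0; first by rewrite mnmBE mnm1E eqxx subn1.
by move=> i ji; rewrite mnmBE al0 // sub0n.
Qed.

Lemma last_row al : al != 0%MM -> exists2 j : 'I_n, (0 < al j)%N &
  forall i : 'I_n, (j < i)%N -> al i = 0%N.
Proof.
move=> nz; have [j0 j0P] : exists j, al j != 0%N.
  apply: contrapT => no; case/eqP: nz; apply/mnmP => i; rewrite mnm0E.
  by apply/eqP; apply: contrapT => /negP ?; apply: no; exists i.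
case: (@arg_maxnP 'I_n j0 (fun j => al j != 0%N) (@nat_of_ord n) j0P) => j jP jmax.
exists j; rewrite ?lt0n // => i ji; apply/eqP; apply: contraTT ji => /jmax.
by rewrite -leqNgt.
Qed.

(** The [K]-th box of row [j] has content 0 and can belong to a strip. *)
Definition critical (j : 'I_n) (K : nat) : Prop :=
  [/\ (0 < K)%N, content j K.-1 = 0 &
      forall (l : 'I_n) m, (l < j)%N -> mu l = mu j + m%:R -> (K <= m)%N].

(** By dominance, the contents of the boxes of different rows that can belong
    to a strip lie in disjoint ranges of integers. *)
Lemma critical_unique j K j' K' : critical j K -> critical j' K' -> j = j' /\ K = K'.
Proof.
have eq_content i (s s' : nat) : content i s = 0 -> content i s' = 0 -> s = s'.
  move=> /eqP; rewrite /content subr_eq0 => /eqP e /eqP; rewrite subr_eq0 => /eqP e'.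
  by apply: natF_inj; apply: (addrI (mu_sum mu + mu i)); rewrite e e'.
have no (i i' : 'I_n) (k k' : nat) : (i < i')%N -> critical i k -> critical i' k' -> False.
  move=> ii' [k0 ck _] [k0' ck' dom].
  have [m mu_m _] := highest_dominance charF V_rep V_irr nz_v wt_v sing_v ii'.
  have k'm := dom i m ii' mu_m.
  have : (m - k' + k + (i' - i))%:R = 0 :> F.
    rewrite !natrD !natrB ?(ltnW ii') //.
    transitivity (content i k.-1 - content i' k'.-1).
      rewrite /content mu_m -!subn1 !natrB //; ring.
    by rewrite ck ck' subrr.
  move/eqP; rewrite natF0; lia.
move=> cj cj'; have jj' : j = j'.
  case: (ltngtP j j') => [h|h|/val_inj //].
    by case: (no _ _ _ _ h cj cj').
  by case: (no _ _ _ _ h cj' cj).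
split=> //; subst j'; case: cj cj' => [k0 ck _] [k0' ck' _].
by rewrite -(prednK k0) -(prednK k0') (eq_content _ _ _ ck ck').
Qed.

(** In each nonempty row l, the content of the last box plus the number of boxes
    in the later rows is 0.  For the last nonempty row j this is a zero content;
    in an earlier row the content is larger than this zero, so the sum would be
    positive. *)
Lemma primitive_critical al psi : row_weight al psi -> al != 0%MM ->
  (forall i, Pd i psi = 0) -> exists j K, critical j K /\ al = (U_(j) *+ K)%MM.
Proof.
move=> rpsi nz Pd0; have [j al_j al0] := last_row nz.
have [spsi _ nzpsi] := rpsi.
have evalP (l : 'I_n) : (0 < al l)%N ->
    content l (al l).-1 + \sum_(i < n | (l < i)%N) (al i)%:R = 0.
  move=> al_l; have := congr1 (fun g : dual M => g (xv (al - U_(l)))) (Pd0 l).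
  rewrite PdE eval_opP // submK ?lep1mP -?lt0n // dual_zeroE => /eqP.
  rewrite mulf_eq0 (negPf nzpsi) orbF => /eqP e; rewrite -[RHS]e.
  congr (content l _ + _); first by rewrite mnmBE mnm1E eqxx subn1.
  apply: eq_bigr => i li; rewrite mnmBE mnm1E.
  by rewrite -(inj_eq val_inj) /= ltn_eqF // subn0.
have cj : content j (al j).-1 = 0.
  by have := evalP j al_j; rewrite big1 ?addr0 // => i /al0->.
have dom (l : 'I_n) m : (l < j)%N -> mu l = mu j + m%:R -> (al j <= m)%N.
  by move=> lj; exact: (row_weight_strip rpsi lj).
exists j, (al j); split=> //; apply/mnmP => l; rewrite mulmnE mnm1E.
case: eqP => [<-|neq]; first by rewrite mul1n.
rewrite mul0n; case: (ltngtP l j) => [lj|/al0//|/val_inj e]; last by case: neq.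
apply/eqP; apply: contraT; rewrite -lt0n => al_l.
have [m mu_m _] := highest_dominance charF V_rep V_irr nz_v wt_v sing_v lj.
have le_m := dom l m lj mu_m.
have : (m - al j + al l + (j - l) + \sum_(i < n | (l < i)%N) al i)%:R = 0 :> F.
  rewrite !natrD !natrB ?(ltnW lj) // natr_sum.
  transitivity (content l (al l).-1 + \sum_(i < n | (l < i)%N) (al i)%:R
                 - content j (al j).-1).
    rewrite /content mu_m -!subn1 !natrB //; ring.
  by rewrite cj subr0 evalP.
by move/eqP; rewrite natF0; lia.
Qed.

Definition sl_stable_subspace (W : M -> Prop) : Prop :=
  [/\ subspace W, forall a b m, W m -> W (opE a b m),
      forall j m, W m -> W (opD j m) & forall i m, W m -> W (opP i m)].

Lemma kills_stable W : sl_stable_subspace W -> gl_stable Ed (kills W).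
Proof.
move=> [_ EW _ _]; split; first exact: subspace_kills.
by move=> a b psi kpsi m Wm; apply: kpsi; apply: EW.
Qed.

(** Removing boxes of nonzero content from the last row on would lead to the
    functional of the empty strip, which does not vanish on 1 (x) V; so a box of
    content 0 is met. *)
Lemma row_weight_critical W al psi : sl_stable_subspace W ->
    (forall u, W (pure_tensor 1 u)) -> kills W psi -> row_weight al psi ->
  exists j K, critical j K /\ (K <= al j)%N.
Proof.
move=> [subW EW DW PW] W1; have [d] := ubnP (mdeg al); elim: d al psi => // d IH al psi.
rewrite ltnS => le_d kpsi rpsi.
have nz : al != 0%MM.
  apply/eqP => al0; case: rpsi => _ _ /eqP[]; rewrite al0 mpolyX0; exact: kpsi.
have [j al_j al0] := last_row nz.
have [cj|ncj] := eqVneq (content j (al j).-1) 0.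
  exists j, (al j); split=> //; split=> // l m lj; exact: (row_weight_strip rpsi lj).
have rP := row_removal rpsi al0 al_j ncj.
have kP : kills W (Pd j psi) by move=> m Wm; apply: kpsi; apply: PW.
have [|j' [K [cK le_K]]] := IH _ _ _ kP rP.
  have := congr1 (@mdeg n) (submK (_ : U_(j) <= al)%MM); rewrite lep1mP -lt0n mdegD mdeg1.
  by move=> /(_ al_j); lia.
by exists j', K; split=> //; apply: leq_trans le_K _; rewrite mnmBE leq_subr.
Qed.

Lemma row_insertion al psi (j : 'I_n) : row_weight al psi ->
    (forall (l : 'I_n) m, (l < j)%N -> mu l = mu j + m%:R -> (al j < m)%N) ->
  exists2 phi, row_weight (al + U_(j))%MM phi &
    forall Z, gl_stable Ed Z -> (forall c, Z (Xd c psi)) -> Z phi.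
Proof.
move=> rpsi room; have [spsi wpsi nz] := rpsi.
pose lam a := mu a + (al a)%:R.
have gap (c : 'I_n) : (c < j)%N -> exists m, mu c = mu j + (al j + m.+1)%:R.
  move=> cj; have [m mu_m _] := highest_dominance charF V_rep V_irr nz_v wt_v sing_v cj.
  by exists (m - al j).-1; have := room c m cj mu_m; rewrite mu_m => h; congr (_ + _%:R); lia.
have neq_t (c : 'I_n) : (c < j)%N -> (lam j - j%:R) - (lam c - c%:R) != 0.
  move=> cj; have [m mu_c] := gap c cj.
  have -> : (lam j - j%:R) - (lam c - c%:R) = - (m.+1 + al c + (j - c))%:R.
    by rewrite /lam mu_c !natrD natrB 1?ltnW //; ring.
  by rewrite oppr_eq0 natF0 addSn.
pose ev (c : 'I_n) (eta : dual M) := eta (xv (al + U_(c))) / (al c).+1%:R.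
have nzS k : k.+1%:R != 0 :> F by rewrite natF0.
have ev_lin c k eta zeta : ev c (k *: eta + zeta) = k * ev c eta + ev c zeta.
  by rewrite /ev dual_addE dual_scaleE mulrDl mulrA.
have evE (c l : 'I_n) eta : (l < c)%N -> ev c (Ed c l eta) = (al l).+1%:R * ev l eta.
  move=> lc; rewrite /ev EdE opE_pure mulX_mderiv_add sing_v // pure_tensor0r addr0.
  by rewrite pure_tensorZl dualZ mulrAC divff // mul1r mulrCA divff // mulr1.
have evX c : ev c (Xd c psi) = psi (xv al).
  rewrite /ev XdE opD_pure mderivX mnmDE mnm1E eqxx addn1 addmK pure_tensorZl dualZ.
  by rewrite mulrAC divff // mul1r.
have [phi [sphi wphi ev_phi memphi]] := exists_row_insertion Ed_relations
  Ed_Xd wpsi spsi neq_t ev_lin evE evX.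
exists phi => //; split=> // [a|].
  by rewrite wphi mnmDE mnm1E natrD addrA [j == a]eq_sym.
have : ev j phi != 0.
  rewrite ev_phi mulf_neq0 //; apply/prodf_neq0 => l lj.
  rewrite mulf_neq0 ?invr_eq0 ?neq_t //; have [m mu_l] := gap l lj.
  have -> : lam j - j%:R - (lam l - l%:R) + (al l).+1%:R = - (m + (j - l))%:R.
    by rewrite /lam mu_l !natrD natrB 1?ltnW //; ring.
  by rewrite oppr_eq0 natF0; lia.
by rewrite /ev mulf_eq0 negb_or => /andP[].
Qed.

(** Insertion only uses derivations and gl(n), which preserve the functionals
    that kill a submodule. *)
Lemma kills_larger_strip W al be psi phi : sl_stable_subspace W ->
    row_weight al psi -> kills W psi -> row_weight be phi -> (al <= be)%MM ->
  kills W phi.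
Proof.
move=> stW rpsi kpsi rphi; have [d] := ubnP (mdeg (be - al)%MM).
have [subW EW DW PW] := stW.
elim: d al psi rpsi kpsi => // d IH al psi rpsi kpsi; rewrite ltnS => le_d le_al.
have [e|neq] := eqVneq (be - al)%MM 0%MM.
  have eq_al : al = be by rewrite -(submK le_al) e add0m.
  rewrite (row_weight_proportional rphi (_ : row_weight be psi)) -?eq_al //.
  exact: (subspaceZ (subspace_kills W)).
have [j j0 _] := last_row neq; move: j0; rewrite mnmBE subn_gt0 => lt_j.
have [|phi' rphi' memphi'] := @row_insertion al psi j rpsi.
  by move=> l m lj mu_m; apply: leq_trans lt_j _; exact: (row_weight_strip rphi lj).
have kphi' : kills W phi'.
  apply: memphi'; first exact: kills_stable.
  by move=> c m Wm; rewrite XdE; apply: kpsi; exact: DW.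
apply: (IH _ _ rphi' kphi').
  have e : (be - (al + U_(j)) + U_(j))%MM = (be - al)%MM.
    apply/mnmP => i; rewrite !mnmDE !mnmBE mnmDE mnm1E.
    by case: eqP => [<-|]; lia.
  by have := congr1 (@mdeg n) e; rewrite mdegD mdeg1; lia.
apply/mnm_lepP => i; rewrite mnmDE mnm1E; case: eqP => [<-|_]; rewrite ?addn1 // addn0.
by move/mnm_lepP: le_al.
Qed.

(** * Functionals of bounded degree *)

Definition one_subspace (W : M -> Prop) : Prop := forall u, W (pure_tensor 1 u).

(** Unlike the full dual, these functionals form finite-dimensional
    gl(n)-modules. *)
Definition deg_lt (K : nat) (psi : dual M) : Prop :=
  forall be u, (K <= mdeg be)%N -> psi (pure_tensor 'X_[be] u) = 0.

Lemma deg_lt_subspace K : subspace (deg_lt K).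
Proof.
split=> [be u _|c f g f0 g0 be u le_K]; first exact: dual_zeroE.
by rewrite dual_addE dual_scaleE f0 // g0 // mulr0 addr0.
Qed.

Lemma deg_lt_stable K : gl_stable Ed (deg_lt K).
Proof.
split=> [|a b psi psi0 be u le_K]; first exact: deg_lt_subspace.
rewrite EdE opE_pure mulX_mderivX dualD pure_tensorZl dualZ [X in _ + X]psi0 // addr0.
have [->|nz] := eqVneq (be a) 0%N; first by rewrite mul0r.
rewrite psi0 ?mulr0 // mdegD mdeg1 addn1.
suff -> : (mdeg (be - U_(a))).+1 = mdeg be by [].
by rewrite -{2}(submK (_ : U_(a) <= be)%MM) ?lep1mP // mdegD mdeg1 addn1.
Qed.

Lemma deg_lt_Pd K i psi : deg_lt K.+1 psi -> deg_lt K (Pd i psi).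
Proof.
move=> psi0 be u le_K; rewrite PdE opP_act vf_act_p 2!dualD dual_sum.
have XE j : 'X_j * 'X_[be] = 'X_[be + U_(j)] :> A by rewrite mpolyXD mulrC.
have le_K' j : (K.+1 <= mdeg (be + U_(j)))%N by rewrite mdegD mdeg1 addn1.
rewrite XE [in X in _ + X + _]psi0 // [X in _ + X]big1 => [|j _]; last by rewrite XE psi0.
rewrite (eq_bigr (fun r => (be r)%:R *: ('X_[be] : A))) => [|r _]; last first.
  exact: mulX_mderiv_diag.
by rewrite -scaler_suml -scalerAr XE pure_tensorZl dualZ psi0 // mulr0 !addr0.
Qed.

Lemma deg_lt_spanning K : exists bs : seq (M * {ffun 'I_n -> F}),
  (forall p, p \in bs -> weighted opE p) /\
  forall psi, deg_lt K psi -> (forall p, p \in bs -> psi p.1 = 0) -> psi = 0.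
Proof.
have [us [wus span_us]] := weight_spanning V_rep V_irr nz_v wt_v sing_v.
pose G (be : 'X_{1..n < K}) (p : V * {ffun 'I_n -> F}) : M * {ffun 'I_n -> F} :=
  (pure_tensor 'X_[be] p.1, [ffun a => (be a)%:R + p.2 a]).
exists [seq G b p | b <- enum {: 'X_{1..n < K}}, p <- us]; split.
  move=> q /allpairsP[[b p] /= [_ pus ->]] a.
  by rewrite /= ffunE; exact: (pure_weight b (wus p pus)).
move=> psi Zpsi psi0; apply: dualP => m; rewrite dual_zeroE; move: m.
apply: tensor_monomial_ind => [|be u]; first exact: subspace_kernel.
have [le_K|lt_K] := leqP K (mdeg be); first exact: Zpsi.
move: u; apply: span_us => [|p pus].
  split=> [|c x y x0 y0]; first by rewrite pure_tensor0r dual0.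
  by rewrite pure_tensorDr pure_tensorZr dual_lin x0 y0 mulr0 addr0.
apply: (psi0 (G (BMultinom lt_K) p)); apply/allpairsP.
by exists (BMultinom lt_K, p); split; rewrite ?mem_enum.
Qed.

Lemma deg_lt_split K : torus_split Ed (deg_lt K).
Proof.
have [bs [wbs bs0]] := deg_lt_spanning K.
move=> c; exists (torus_values c bs); first exact: undup_uniq.
move=> psi Zpsi; apply: bs0.
  have [subZ EZ] := deg_lt_stable K; apply: (spectral_stable _ subZ) => // phi Zphi.
  by apply: (subspace_sum subZ) => a _; apply: (subspaceZ subZ); exact: EZ.
move=> p p_bs; have wp := torus_weight c (wbs p p_bs).
have evalE rs : spectral (torus Ed c) rs psi p.1 =
    \prod_(r <- rs) (\sum_a c a * p.2 a - r) * psi p.1.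
  elim: rs => [|r rs IH]; first by rewrite big_nil mul1r.
  rewrite big_cons -[LHS]/((torus Ed c (spectral (torus Ed c) rs psi)
    - r *: spectral (torus Ed c) rs psi) p.1).
  rewrite dual_addE dual_oppE dual_scaleE dual_sumE.
  rewrite (eq_bigr (fun a => spectral (torus Ed c) rs psi (c a *: opE a a p.1))).
    rewrite -dual_sum -/(torus opE c p.1) wp dualZ IH; ring.
  by move=> a _; rewrite dualZ.
have in_rs : \sum_a c a * p.2 a \in torus_values c bs.
  by rewrite mem_undup; apply/mapP; exists p.
by rewrite evalE (big_rem _ in_rs) /= subrr !mul0r.
Qed.

Lemma deg_lt_dim K : finite_dimensional (deg_lt K).
Proof.
have [bs [_ bs0]] := deg_lt_spanning K.
exists (size bs).+1 => y Zy.
pose G := \matrix_(i < (size bs).+1, j < size bs) y i (tnth (in_tuple bs) j).1.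
have /rowV0Pn[p /sub_kermxP pG nz_p] : kermx G != 0.
  rewrite kermx_eq0 /row_free; apply: contraTneq (rank_leq_col G) => ->.
  by rewrite ltnn.
exists (p 0).
  apply: contrapT => no; case/eqP: nz_p; apply/rowP => i; rewrite mxE.
  by apply/eqP; apply: contrapT => /negP ?; apply: no; exists i.
apply: bs0 => [|q qbs].
  by apply: (subspace_sum (deg_lt_subspace K)) => i _; apply: (subspaceZ (deg_lt_subspace K)).
have /tnthP[j ->] : q \in in_tuple bs by [].
have := congr1 (fun N : 'rV[F]_(size bs) => N 0 j) pG; rewrite !mxE => <-.
by rewrite dual_sumE; apply: eq_bigr => i _; rewrite dual_scaleE mxE.
Qed.

Lemma torus_split_sub (Z Z' : dual M -> Prop) : (forall psi, Z' psi -> Z psi) ->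
  torus_split Ed Z -> torus_split Ed Z'.
Proof. by move=> sub sp c; have [rs ? rs0] := sp c; exists rs => // psi /sub/rs0. Qed.

Lemma finite_dimensional_sub (Z Z' : dual M -> Prop) : (forall psi, Z' psi -> Z psi) ->
  finite_dimensional Z -> finite_dimensional Z'.
Proof. by move=> sub [N dimZ]; exists N => y Zy; apply: dimZ => i; apply: sub. Qed.

Lemma gl_stable_and (Z Z' : dual M -> Prop) : gl_stable Ed Z -> gl_stable Ed Z' ->
  gl_stable Ed (fun psi => Z psi /\ Z' psi).
Proof.
move=> [sZ EZ] [sZ' EZ']; split=> [|a b psi [Zpsi Z'psi]]; last first.
  by split; [exact: EZ | exact: EZ'].
split=> [|c f g [Zf Z'f] [Zg Z'g]]; first by split; [exact: sZ.1 | exact: sZ'.1].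
by split; [exact: sZ.2 | exact: sZ'.2].
Qed.

Lemma exists_row_weight (Z : dual M -> Prop) K psi : gl_stable Ed Z ->
    (forall phi, Z phi -> deg_lt K phi) -> Z psi -> psi != 0 ->
  exists al phi, row_weight al phi /\ Z phi.
Proof.
move=> stZ subZ Zpsi /eqP nz; have splitZ := torus_split_sub subZ (@deg_lt_split K).
have [y [lam [Zy nzy wy]]] :=
  exists_weight Ed_relations stZ splitZ (subspace_null _) Zpsi nz.
have [phi [s [Zphi nzphi _ wphi sphi]]] :=
  exists_singular_mod charF Ed_relations stZ splitZ (subspace_null _) Zy nzy wy.
have [al rphi _] := singular_row_weight sphi wphi (introN eqP nzphi).
by exists al, phi.
Qed.

Definition hcomp (k : nat) (m : M) : M := [ffun i => pihomog mdeg k (m i)].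

Lemma hcomp_linear k : linear (hcomp k).
Proof. by move=> c x y; apply/ffunP => i; rewrite !ffunE linearP. Qed.

Lemma hcomp_pure k be u : hcomp k (pure_tensor 'X_[be] u) =
  (mdeg be == k)%:R *: pure_tensor 'X_[be] u.
Proof.
apply/ffunP => i; rewrite !ffunE linearZ /= pihomogX.
by case: eqP; rewrite ?scale1r ?scale0r ?scaler0.
Qed.

Definition euler : {linear M -> M} := torus opE (fun=> 1).

Lemma euler_pure be u :
  euler (pure_tensor 'X_[be] u) = ((mdeg be)%:R + mu_sum mu) *: pure_tensor 'X_[be] u.
Proof.
rewrite -[LHS]/(torus opE (fun=> 1) _) /torus.
rewrite (eq_bigr (fun a => (be a)%:R *: pure_tensor ('X_[be] : A) u
                           + pure_tensor 'X_[be] (E a a u))) => [|a _].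
  rewrite big_split /= -scaler_suml -pure_tensor_sumr.
  rewrite (trace_scalar V_rep V_irr nz_v wt_v sing_v) pure_tensorZr -scalerDl.
  by rewrite mdegE natr_sum.
by rewrite scale1r opE_pure mulX_mderiv_diag pure_tensorZl.
Qed.

Lemma euler_hcomp k m : euler (hcomp k m) = (k%:R + mu_sum mu) *: hcomp k m.
Proof.
move: m; apply: tensor_monomial_ind => [|be u].
  apply: lin_eq; first exact: lin_comp (linearP euler) (hcomp_linear k).
  exact: lin_scale (hcomp_linear k).
rewrite hcomp_pure; case: eqP => [<-|_]; first by rewrite scale1r euler_pure.
by rewrite scale0r linear0 scaler0.
Qed.

Lemma sum_hcomp m k : exists2 K, (k < K)%N & m = \sum_(j <- iota 0 K) hcomp j m.
Proof.
pose K0 := \max_i msize (m i); exists (maxn k.+1 K0); first by rewrite leq_max leqnn.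
apply/ffunP => i; rewrite sum_ffunE.
have le_K : (msize (m i) <= maxn k.+1 K0)%N.
  by rewrite leq_max orbC (leq_bigmax (F := fun i => msize (m i)) i).
rewrite [LHS](pihomog_partitionE (mf := mdeg) le_K).
rewrite -(big_mkord xpredT (fun j => pihomog mdeg j (m i))) /index_iota subn0.
by apply: eq_bigr => j _; rewrite ffunE.
Qed.

(** The Euler field separates degrees, so submodules are graded. *)
Lemma submodule_graded W m k : sl_stable_subspace W -> W m -> W (hcomp k m).
Proof.
move=> [subW EW _ _] Wm; have [K kK mE] := sum_hcomp m k.
pose rs := [seq j%:R + mu_sum mu | j <- iota 0 K & j != k].
have Ws : W (spectral euler rs m).
  apply: (spectral_stable _ subW) => // x Wx; apply: (subspace_sum subW) => a _.
  by apply: (subspaceZ subW); exact: EW.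
pose p j := \prod_(r <- rs) (j%:R + mu_sum mu - r) : F.
have specE : spectral euler rs m = p k *: hcomp k m.
  have lin_s : linear (spectral euler rs) := spectral_linear euler rs.
  have sum_s (s : seq nat) : spectral euler rs (\sum_(j <- s) hcomp j m) =
      \sum_(j <- s) p j *: hcomp j m.
    elim: s => [|j s IH]; first by rewrite !big_nil linear_zero.
    rewrite !big_cons -[hcomp j m]scale1r lin_s IH !scale1r.
    by rewrite (spectral_eigen rs (euler_hcomp j m)).
  rewrite {1}mE sum_s (bigD1_seq k) ?iota_uniq ?mem_iota //=.
  rewrite big_seq_cond big1 ?addr0 //.
  move=> j /andP[jK neq]; rewrite /p (big_rem (j%:R + mu_sum mu)) /= ?subrr ?mul0r ?scale0r //.
  by apply/mapP; exists j => //; rewrite mem_filter neq.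
have nzp : p k != 0.
  rewrite /p big_map prodf_seq_neq0; apply/allP => j; rewrite mem_filter => /andP[neq _].
  rewrite /= opprD addrACA subrr addr0 subr_eq0 eq_sym.
  by apply: contra neq => /eqP/natF_inj->.
by rewrite -[hcomp k m](scalerK nzp) -specE; apply: (subspaceZ subW).
Qed.

(** Since [W] is graded, the row of coefficients of degree [k] of [m] differs
    from those of all elements of [W]; linear algebra in this finite-dimensional
    space provides the functional. *)
Lemma separation W m k : sl_stable_subspace W -> ~ W (hcomp k m) ->
  exists psi, [/\ deg_lt k.+1 psi, kills W psi & psi m != 0].
Proof.
move=> stW nWm; have [subW _ _ _] := stW.
pose B : finType := ('I_(\dim {:V}) * 'X_{1..n < k.+1})%type.
pose ent (t : 'I_#|B|) : 'I_(\dim {:V}) * 'X_{1..n < k.+1} := enum_val t.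
pose co (x : M) : 'rV[F]_#|B| := \row_t (hcomp k x (ent t).1)@_(ent t).2.
have lin_co : linear co.
  move=> c x y; apply/rowP => t; rewrite !mxE hcomp_linear !ffunE.
  by rewrite linearP.
have co0 x : co x = 0 -> hcomp k x = 0.
  move=> cx; apply/ffunP => i; rewrite [RHS]ffunE; apply/mpolyP => be; rewrite mcoeff0.
  have [deg_be|neq] := eqVneq (mdeg be) k; last first.
    rewrite ffunE pihomogE raddf_sum /= big1 // => g /eqP gk.
    rewrite linearZ /= mcoeffX; have [e|_] := eqVneq g be; last by rewrite mulr0.
    by rewrite -e gk eqxx in neq.
  have lt_be : (mdeg be < k.+1)%N by rewrite deg_be.
  pose x0 : B := (i, BMultinom lt_be).
  have := congr1 (fun r : 'rV[F]_#|B| => r 0 (enum_rank x0)) cx.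
  by rewrite !mxE /ent enum_rankK.
pose P r := exists2 x, W x & r = co x.
have subP : subspace P.
  split=> [|c r s [x Wx ->] [y Wy ->]]; last first.
    by exists (c *: x + y); [exact: subW.2 | rewrite lin_co].
  by exists 0; [exact: subW.1 | rewrite linear_zero].
have nPm : ~ P (co m).
  move=> [x Wx eq_co]; apply: nWm.
  have e : hcomp k (m - x) = 0 by apply: co0; rewrite linear_sub // eq_co subrr.
  have -> : hcomp k m = hcomp k x.
    by apply/eqP; rewrite -subr_eq0 -linear_sub ?e //; exact: hcomp_linear.
  exact: submodule_graded.
have [phi [phi0 nz_phi]] := row_separation subP nPm.
have lin_psi : linear ((fun x => (co x *m phi) 0 0) : M -> F^o).
  by move=> c x y; rewrite lin_co mulmxDl -scalemxAl mxE [X in X + _]mxE.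
exists (Dual lin_psi); split=> [be u lt_k|x Wx|] /=.
- have -> : co (pure_tensor 'X_[be] u) = 0; last by rewrite mul0mx mxE.
  apply/rowP => t; rewrite !mxE hcomp_pure gtn_eqF // scale0r ffunE.
  exact: mcoeff0.
- by rewrite phi0 ?mxE //; exists x.
apply: contraNneq nz_phi => e; apply/eqP/rowP => i; rewrite ord1 e mxE //.
Qed.

Lemma exists_hcomp_outside W m : sl_stable_subspace W -> ~ W m ->
  exists k, ~ W (hcomp k m).
Proof.
move=> [subW _ _ _] nWm; apply: contrapT => no; apply: nWm.
have [K _ ->] := sum_hcomp m 0; apply: (subspace_sum subW) => j _.
by apply: contrapT => ?; apply: no; exists j.
Qed.

(** * The submodule generated by 1 (x) V *)

Lemma opE_one a b u : opE a b (pure_tensor 1 u) = pure_tensor 1 (E a b u).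
Proof.
by rewrite opE_pure -mpolyC1 mderivC mulr0 pure_tensor0l add0r.
Qed.

Lemma opD_one j u : opD j (pure_tensor 1 u) = 0.
Proof. by rewrite opD_pure -mpolyC1 mderivC pure_tensor0l. Qed.

Lemma pure_one_eq0 u : pure_tensor (1 : A) u = 0 -> u = 0.
Proof.
move=> e; rewrite (coord_vbasis (memvf u)) big1 // => i _.
have := congr1 (fun m : M => (m i)@_0%MM) e; rewrite !ffunE mcoeffZ mcoeff0.
by rewrite mcoeff1 eqxx mulr1 => ->; rewrite scale0r.
Qed.

Lemma opDE j m i : opD j m i = mderiv j (m i).
Proof.
move: m; apply: tensor_ind => [|f u]; last by rewrite opD_pure !ffunE mderivZ.
split=> [|c x y ex ey]; first by rewrite linear0 !ffunE mderiv0.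
by rewrite linearP !ffunE /= ex ey mderivD mderivZ.
Qed.

(** Differentiating down to degree 0, every nonzero submodule meets, hence
    contains, 1 (x) V. *)
Lemma nonzero_contains_one W m : sl_stable_subspace W -> W m -> m != 0 ->
  one_subspace W.
Proof.
move=> [subW EW DW PW] Wm nzm.
suff [u nz_u Wu] : exists2 u, u != 0 & W (pure_tensor 1 u).
  move=> w; apply: (glV_submodule V_irr (W := fun u => W (pure_tensor 1 u)) _ Wu nz_u).
  split=> [|a b x Wx]; last by rewrite -opE_one; exact: EW.
  split=> [|c x y Wx Wy]; first by rewrite pure_tensor0r; exact: subW.1.
  by rewrite pure_tensorDr pure_tensorZr; exact: subW.2.
have [K lt_K] : exists K, forall i be, (K <= mdeg be)%N -> (m i)@_be = 0.
  exists (\max_i msize (m i)) => i be le_be; apply/eqP; rewrite -[_ == 0]negbK.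
  rewrite -mcoeff_msupp; apply: msize_mdeg_ge; apply: leq_trans le_be.
  exact: (leq_bigmax (F := fun i => msize (m i)) i).
elim: K m Wm nzm lt_K => [|K IH] m Wm nzm lt_K.
  case/eqP: nzm; apply/ffunP => i; rewrite ffunE; apply/mpolyP => be.
  by rewrite lt_K // mcoeff0.
have [[j nz_j]|const] := pselect (exists j, opD j m != 0).
  apply: (IH _ (DW j m Wm) nz_j) => i be le_be.
  by rewrite opDE mcoeff_deriv lt_K ?mul0rn // mdegD mdeg1 addn1.
have m_const i : m i = (m i)@_0 *: 1.
  apply/mpolyP => be; rewrite mcoeffZ mcoeff1.
  have [->|nz] := eqVneq be 0%MM; first by rewrite mulr1.
  rewrite mulr0; have [j be_j _] := last_row nz.
  have Dj : opD j m = 0 by apply/eqP; apply: contrapT => /negP ?; apply: const; exists j.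
  have := congr1 (fun x : M => (x i)@_(be - U_(j))) Dj.
  rewrite opDE mcoeff_deriv submK ?lep1mP -?lt0n // !ffunE mcoeff0 => /eqP.
  by rewrite -mulr_natr mulf_eq0 natF0 orbF => /eqP.
pose u := \sum_i (m i)@_0 *: (vbasis {:V})`_i.
have mE : m = pure_tensor 1 u.
  rewrite pure_tensor_sumr [LHS]poly_tensor_sum; apply: eq_bigr => i _.
  by rewrite {1}m_const pure_tensorZl pure_tensorZr.
exists u; last by rewrite -mE.
by apply: contraNneq nzm => u0; rewrite mE u0 pure_tensor0r.
Qed.

(** The span of the products of the p_i applied to 1 (x) V, in the form of its
    induction principle. *)
Definition generated (m : M) : Prop := forall Q : M -> Prop,
  subspace Q -> one_subspace Q -> (forall i x, Q x -> Q (opP i x)) -> Q m.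

Lemma generated_min W : sl_stable_subspace W -> one_subspace W ->
  forall m, generated m -> W m.
Proof. by move=> [subW _ _ PW] W1 m; apply. Qed.

Lemma generated_one : one_subspace generated.
Proof. by move=> u Q. Qed.

Lemma generated_subspace : subspace generated.
Proof.
split=> [Q subQ _ _|c x y Gx Gy Q subQ Q1 PQ]; first exact: subQ.1.
by apply: subQ.2; [exact: Gx | exact: Gy].
Qed.

Lemma generated_opP i m : generated m -> generated (opP i m).
Proof. by move=> Gm Q subQ Q1 PQ; apply: (PQ); apply: Gm. Qed.

Lemma generated_opE a b m : generated m -> generated (opE a b m).
Proof.
have subG := generated_subspace.
move=> Gm; suff: generated m /\ forall a b, generated (opE a b m) by case.
apply: (Gm (fun m => generated m /\ forall a b, generated (opE a b m))).
- split=> [|k x y [Gx Ex] [Gy Ey]].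
    by split=> [|c d]; rewrite ?linear0; exact: subG.1.
  by split=> [|c d]; rewrite ?linearP; exact: subG.2.
- by move=> u; split=> [|c d]; rewrite ?opE_one; exact: generated_one.
move=> i x [Gx Ex]; split=> [|c d]; first exact: generated_opP.
rewrite (opE_opP V_rep (trace_scalar V_rep V_irr nz_v wt_v sing_v)).
by apply: (subspaceD subG); [|apply: (subspaceZ subG)]; exact: generated_opP.
Qed.

Lemma generated_opD j m : generated m -> generated (opD j m).
Proof.
have subG := generated_subspace.
move=> Gm; suff: generated m /\ forall j, generated (opD j m) by case.
apply: (Gm (fun m => generated m /\ forall j, generated (opD j m))).
- split=> [|k x y [Gx Dx] [Gy Dy]].
    by split=> [|c]; rewrite ?linear0; exact: subG.1.
  by split=> [|c]; rewrite ?linearP; exact: subG.2.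
- move=> u; split=> [|c]; first exact: generated_one.
  by rewrite opD_one; exact: subG.1.
move=> i x [Gx Dx]; split=> [|c]; first exact: generated_opP.
rewrite (opD_opP (trace_scalar V_rep V_irr nz_v wt_v sing_v)).
apply: (subspaceD subG); first apply: (subspaceD subG).
- exact: generated_opP.
- exact: generated_opE.
by apply: (subspaceZ subG); apply: (subspace_sum subG) => r _; exact: generated_opE.
Qed.

Lemma generated_stable : sl_stable_subspace generated.
Proof.
split; [exact: generated_subspace | exact: generated_opE | exact: generated_opD |].
exact: generated_opP.
Qed.

Lemma exists_empty_strip : exists psi, row_weight 0%MM psi.
Proof.
have st0 : sl_stable_subspace (fun m => m = 0).
  by split=> [|a b m ->|j m ->|i m ->]; rewrite ?linear0 //; exact: subspace_null.
have nz0 : ~ hcomp 0 (pure_tensor 1 v) = 0.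
  rewrite -mpolyX0 hcomp_pure mdeg0 eqxx scale1r mpolyX0 => /pure_one_eq0.
  exact/eqP.
have [psi [Zpsi _ nz]] := separation st0 nz0.
have nz_psi : psi != 0 by apply: contraNneq nz => ->; rewrite dual_zeroE.
have [al [phi [rphi Zphi]]] := exists_row_weight (@deg_lt_stable 1) (fun _ => id) Zpsi nz_psi.
exists phi; suff <- : al = 0%MM by [].
apply/eqP; rewrite -mdeg_eq0 -leqn0 -ltnS leqNgt; apply/negP => lt0.
by case: rphi => _ _ /eqP[]; apply: Zphi.
Qed.

Lemma exists_critical_row j K : critical j K -> exists psi, row_weight (U_(j) *+ K)%MM psi.
Proof.
move=> [_ _ dom]; suff H k : (k <= K)%N -> exists psi, row_weight (U_(j) *+ k)%MM psi.
  exact: H.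
elim: k => [_|k IH lt_k]; first by rewrite mulm0n; exact: exists_empty_strip.
have [psi rpsi] := IH (ltnW lt_k).
have [|phi rphi _] := @row_insertion _ _ j rpsi.
  move=> l m lj mu_m; rewrite mulmnE mnm1E eqxx mul1n.
  by apply: leq_trans lt_k _; apply: dom mu_m.
by exists phi; rewrite mulmSr.
Qed.

(** For i <> j the weight K eps_j - eps_i is not in N^n, and for i = j the factor
    is the content 0 of the critical box. *)
Lemma critical_primitive j K psi : critical j K -> row_weight (U_(j) *+ K)%MM psi ->
  forall i, Pd i psi = 0.
Proof.
move=> [K0 cK _] rpsi i; have [k] := ubnP (n - i)%N; elim: k i => // k IH i.
rewrite ltnS => ik; have Pd0 (i' : 'I_n) : (i < i')%N -> Pd i' psi = 0.
  by move=> ii'; apply: IH; apply: leq_trans ik; rewrite ltn_sub2l.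
have [e|neq] := eqVneq j i; last first.
  by apply: (Pd_empty_row rpsi Pd0); rewrite mulmnE mnm1E (negPf neq).
subst i; apply/eqP; apply: contraT => nz.
have [sP wP] := Pd_singular rpsi Pd0.
have [be [_ _ nz_be] be_wt] := singular_row_weight sP wP nz.
have beE : be = (U_(j) *+ K.-1)%MM.
  apply/mnmP => a; apply: natF_inj; apply: (addrI (mu a)); rewrite -be_wt -addrA.
  congr (_ + _); rewrite !mulmnE mnm1E [a == j]eq_sym.
  by case: eqP; rewrite ?mul0n ?subr0 // !mul1n -natrB // subn1.
case/eqP: nz_be; rewrite beE PdE eval_opP; last by case: rpsi.
rewrite mulmnE mnm1E eqxx mul1n cK big1 ?addr0 ?mul0r // => i ji.
by rewrite mulmnE mnm1E -(inj_eq val_inj) /= ltn_eqF.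
Qed.

Lemma critical_not_generated j K : critical j K -> exists m, ~ generated m.
Proof.
move=> cK; have [psi rpsi] := exists_critical_row cK.
have Pd0 := critical_primitive cK rpsi; have [spsi wpsi nz] := rpsi.
exists (pure_tensor 'X_[U_(j) *+ K] v) => gen; case/eqP: nz.
apply: (gen (fun m => psi m = 0)); first exact: subspace_kernel.
  move=> u; have [K0 _ _] := cK; apply/eqP.
  have := congr1 psi (euler_pure 0%MM u); rewrite mpolyX0 dualZ mdeg0 add0r.
  rewrite -[euler _]/(torus opE (fun=> 1) _) /torus dual_sum.
  rewrite (eq_bigr (fun a => (mu a + ((U_(j) *+ K)%MM a)%:R) * psi (pure_tensor 1 u))).
    rewrite -mulr_suml big_split /= -natr_sum -mdegE mdegMn mdeg1 mul1n.
    move/eqP; rewrite mulrDl -subr_eq0 addrAC subrr add0r mulf_eq0 natF0.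
    by rewrite eqn0Ngt K0.
  move=> a _; rewrite scale1r -EdE wpsi; exact: dual_scaleE.
move=> i x _; have := congr1 (fun f : dual M => f x) (Pd0 i).
by rewrite PdE dual_zeroE.
Qed.

(** The transpose of p_i lowers the degree of a functional and preserves the
    functionals that kill [W].  So, for the least degree in which there is a
    nonzero one, all these transposes vanish. *)
Lemma proper_critical W m : sl_stable_subspace W -> one_subspace W -> ~ W m ->
  exists j K psi, [/\ critical j K, row_weight (U_(j) *+ K)%MM psi & kills W psi].
Proof.
move=> stW W1 nWm; have [k nWk] := exists_hcomp_outside stW nWm.
have [psi [Zpsi kpsi nz]] := separation stW nWk.
have {nz}nz : psi != 0 by apply: contraNneq nz => ->; rewrite dual_zeroE.
move: k.+1 Zpsi => {nWk}k; elim: k psi kpsi nz => [|k IH] psi kpsi nz Zpsi.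
  case/eqP: nz; apply: dualP => x; rewrite dual_zeroE; move: x.
  by apply: tensor_monomial_ind => [|be u]; [exact: subspace_kernel | exact: Zpsi].
have [al [phi [rphi [Zphi kphi]]]] := exists_row_weight
  (gl_stable_and (@deg_lt_stable k.+1) (kills_stable stW)) (fun _ => @proj1 _ _)
  (conj Zpsi kpsi) nz.
have [[i nz_i]|Pd0] := pselect (exists i, Pd i phi != 0).
  apply: (IH (Pd i phi)) => //; last exact: deg_lt_Pd.
  by case: stW => _ _ _ PW x Wx; rewrite PdE; apply: kphi; apply: PW.
have nz_al : al != 0%MM.
  apply/eqP => al0; case: rphi => _ _ /eqP[]; rewrite al0 mpolyX0; exact: kphi.
have [|j [K [cK alE]]] := primitive_critical rphi nz_al.
  by move=> i; apply/eqP; apply: contrapT => /negP ?; apply: Pd0; exists i.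
by exists j, K, phi; rewrite -alE.
Qed.

(** The functional of the critical row kills [W], hence so do the functionals of
    all larger strips, and these are all the singular functionals that kill the
    generated submodule.  A functional that kills the latter but not [W] could
    be replaced by a singular one. *)
Lemma proper_generated W m : sl_stable_subspace W -> one_subspace W -> ~ W m ->
  forall x, W x -> generated x.
Proof.
move=> stW W1 nWm x Wx; apply: contrapT => nGx.
have [j [K [psi [cK rpsi kpsi]]]] := proper_critical stW W1 nWm.
have [k nGk] := exists_hcomp_outside generated_stable nGx.
have [eta [Zeta keta nz_eta]] := separation generated_stable nGk.
pose Z phi := deg_lt k.+1 phi /\ kills generated phi.
pose Z' phi := deg_lt k.+1 phi /\ kills W phi.
have stZ : gl_stable Ed Z := gl_stable_and (@deg_lt_stable _) (kills_stable generated_stable).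
have stZ' : gl_stable Ed Z' := gl_stable_and (@deg_lt_stable _) (kills_stable stW).
have Z'Z phi : Z' phi -> Z phi.
  by case=> Zphi kphi; split=> // y Gy; apply: kphi; exact: (generated_min stW W1).
have sub : forall phi, Z phi -> deg_lt k.+1 phi by move=> phi [].
have nZ'eta : ~ Z' eta by case=> _ /(_ x Wx) e; rewrite e eqxx in nz_eta.
have [phi [lam [[Zphi kphi] nZ'phi wphi sphi]]] := exists_singular_outside charF
  Ed_relations stZ (torus_split_sub sub (@deg_lt_split _))
  (finite_dimensional_sub sub (@deg_lt_dim _)) stZ' Z'Z (conj Zeta keta) nZ'eta.
have nz_phi : phi != 0.
  by apply/eqP => e; apply: nZ'phi; rewrite e; exact: stZ'.1.1.
have [al rphi _] := singular_row_weight sphi wphi nz_phi.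
have [j' [K' [cK' le_K']]] := row_weight_critical generated_stable generated_one kphi rphi.
have [ej eK] := critical_unique cK' cK; subst j' K'.
apply: nZ'phi; split=> //; apply: (kills_larger_strip stW rpsi kpsi rphi).
apply/mnm_lepP => i; rewrite mulmnE mnm1E.
by case: eqP => [<-|_]; rewrite ?mul0n ?mul1n.
Qed.

(** * The weight conditions and irreducibility *)

Lemma intF_inj (s t : int) : s%:~R = t%:~R :> F -> s = t.
Proof.
move=> e; apply/eqP; rewrite -subr_eq0; have : (s - t)%:~R = 0 :> F by rewrite intrB e subrr.
case: (s - t) => k /eqP; first by rewrite natF0.
by rewrite NegzE mulrNz oppr_eq0 natF0.
Qed.

Lemma int_interval_succ (a b x : F) :
  int_interval (a + 1) (b + 1) (x + 1) <-> int_interval a b x.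
Proof.
split=> -[s [t [z [ea eb ex sz zt]]]];
  [exists (s - 1), (t - 1), (z - 1) | exists (s + 1), (t + 1), (z + 1)].
  by rewrite !intrB -ea -eb -ex !addrK !Num.Theory.lerD2r.
by rewrite !intrD ea eb ex !Num.Theory.lerD2r.
Qed.

(** The conditions of the theorem number the critical box in row i + 1 by
    mu_i + |mu| - i, with i counted from 1; this number is mu_i - mu_(i+1) - K + 1. *)
Lemma critical_succ (i j : 'I_n) : j = i.+1 :> nat ->
  (exists K, critical j K) <->
  int_interval 1 (mu i - mu j) (mu i + \sum_k mu k - i.+1%:R).
Proof.
move=> ji; have ij : (i < j)%N by rewrite ji.
have [m mu_i _] := highest_dominance charF V_rep V_irr nz_v wt_v sing_v ij.
have mE : mu i - mu j = m%:R by rewrite mu_i addrAC subrr add0r.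
split=> [[K [K0 cK dom]]|[s [t [z [es et ez sz zt]]]]].
  have Km := dom i m ij mu_i; exists 1%:Z, m%:Z, (m - K + 1)%N%:Z.
  split=> //; try lia.
  rewrite -[RHS]/((m - K + 1)%:R) natrD natrB //.
  have : mu_sum mu = - (mu j + K%:R - 1 - j%:R).
    apply/eqP; rewrite -addr_eq0; apply/eqP; rewrite -[RHS]cK /content -subn1 natrB //; ring.
  by rewrite /mu_sum mu_i ji => ->; ring.
have {es}s1 : s = 1 by apply: intF_inj; rewrite -es.
have {et}tm : t = m%:Z by apply: intF_inj; rewrite -et mE.
subst s t; have [k zE] : exists k : nat, z = k%:Z by exists (absz z); lia.
subst z; have k1 : (1 <= k)%N by lia.
have km : (k <= m)%N by lia.
exists (m - k + 1)%N; split; first by rewrite addn1.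
  move: ez; rewrite /content /mu_sum addn1 /= ji natrB // -[k%:~R]/(k%:R) => <-.
  by rewrite mu_i; ring.
move=> l m' lj mu_l; rewrite addn1 ltn_subLR //.
have [il|li] := eqVneq l i.
  have -> : m' = m by apply: natF_inj; apply: (addrI (mu j)); rewrite -mu_l -mu_i il.
  lia.
have li' : (l < i)%N by rewrite ltn_neqAle (inj_eq val_inj) li -ltnS -ji.
have [m2 mu_l2 _] := highest_dominance charF V_rep V_irr nz_v wt_v sing_v li'.
have -> : m' = (m + m2)%N.
  by apply: natF_inj; apply: (addrI (mu j)); rewrite -mu_l mu_l2 mu_i natrD addrA.
lia.
Qed.

Lemma weight_conditions (n_ge2 : (1 < n)%N) :
  weight_cond_first n_ge2 mu /\ weight_cond_inner mu <->
  ~ exists j K, critical j K.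
Proof.
pose i0 := Ordinal (ltnW n_ge2); pose i1 := Ordinal n_ge2.
have first0 : (exists K, critical i0 K) <-> neg_nat (mu i0 + \sum_j mu j).
  split=> [[K [K0 cK _]]|[k ek]].
    exists K.-1; apply/eqP; rewrite -addr_eq0; apply/eqP; rewrite -[RHS]cK.
    by rewrite /content /mu_sum subr0 [mu i0 + _]addrC.
  exists k.+1; split=> //.
  by rewrite /content /mu_sum /= subr0 [_ + mu i0]addrC ek addNr.
have first1 : (exists K, critical i1 K) <->
    int_interval 2 (1 + (mu i0 - mu i1)) (mu i0 + \sum_j mu j).
  rewrite (critical_succ (i := i0) (j := i1)) // -int_interval_succ.
  by rewrite subrK [mu i0 - mu i1 + 1]addrC.
split=> [[c1 c2] [j [K cK]]|none].
  have [j0|j1|j2] := ltngtP j 1%N.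
  - apply: c1; left; apply/first0; exists K.
    by have -> : i0 = j by apply/val_inj => /=; move: j0; case: (nat_of_ord j).
  - have lt_i : (j.-1 < n)%N by apply: leq_ltn_trans (ltn_ord j); exact: leq_pred.
    have ji : j = (Ordinal lt_i).+1 :> nat by rewrite /= prednK // ltnW.
    apply: (c2 (Ordinal lt_i) j _ ji); first by rewrite /= -ltnS -ji.
    by apply/(critical_succ ji); exists K.
  apply: c1; right; apply/first1; exists K.
  by have -> : i1 = j by apply/val_inj.
split=> [[/first0[K cK]|/first1[K cK]]|i j i_gt0 ji /(critical_succ ji)[K cK]].
- by apply: none; exists i0, K.
- by apply: none; exists i1, K.
by apply: none; exists j, K.
Qed.

Local Notation slM := (@sl_span F n).
Local Notation act := (vf_act rho).

Lemma lie_submodule_stable (W : {pred M}) :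
  lie_submodule slM act W -> sl_stable_subspace (fun m => m \in W).
Proof.
move=> [[W0 WL] aW]; split; first by split.
- by move=> a b m Wm; rewrite opE_act; apply: aW Wm; exact: sl_xpartial.
- by move=> j m Wm; rewrite opD_act; apply: aW Wm; exact: sl_partial.
by move=> i m Wm; rewrite opP_act; apply: aW Wm; exact: sl_p.
Qed.

Lemma stable_act W a m : sl_stable_subspace W -> slM a -> W m -> W (act a m).
Proof.
move=> [subW EW DW PW] sla Wm; apply: sl_stable sla => //.
- by move=> j; rewrite -opD_act; exact: DW.
- by move=> i j; rewrite -opE_act; exact: EW.
by move=> i; rewrite -opP_act; exact: PW.
Qed.

Local Notation U1V := (Uspan slM act (@one_tensor F n V)).

Lemma mem_U1V m : m \in U1V <-> generated m.
Proof.
split=> [/asboolP[r [c [w [s [gw s1 ->]]]]]|].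
  apply: (subspace_sum generated_subspace) => i _.
  apply: (subspaceZ generated_subspace); have [u ->] := s1 i.
  elim: (w i) (gw i) => [_|x l IH gl] /=; first exact: generated_one.
  apply: (stable_act generated_stable).
    by apply: gl; rewrite mem_head.
  by apply: IH => y yl; apply: gl; rewrite in_cons yl orbT.
have [U0 UL] := Uspan_submod_closed slM act (@one_tensor F n V).
apply: (generated_min (W := fun m => m \in U1V)).
  apply: lie_submodule_stable; split=> // x y gx /asboolP[r [c [w [s [gw s1 ->]]]]].
  apply/asboolP; exists r, c, (fun i => x :: w i), s; split=> // [i z|].
    by rewrite in_cons => /predU1P[->//|]; exact: gw.
  by rewrite linear_sum; apply: eq_bigr => i _; rewrite linearZ.
move=> u; apply/asboolP; exists 1%N, (fun=> 1), (fun=> [::]), (fun=> pure_tensor 1 u).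
by split=> // [i|]; [exists u | rewrite big_ord1 scale1r].
Qed.

Lemma U1V_submodule : lie_submodule slM act U1V.
Proof.
split; first exact: Uspan_submod_closed.
move=> x m gx /mem_U1V Gm; apply/mem_U1V.
exact: (stable_act generated_stable).
Qed.

Lemma U1V_min (W : {pred M}) m : lie_submodule slM act W -> m \in W -> m != 0 ->
  {subset U1V <= W}.
Proof.
move=> /lie_submodule_stable stW Wm nz x /mem_U1V.
exact: (generated_min stW (nonzero_contains_one stW Wm nz)).
Qed.

Lemma U1V_one u : pure_tensor 1 u \in U1V.
Proof. by apply/mem_U1V; exact: generated_one. Qed.

Lemma pure_one_neq0 : pure_tensor (1 : A) v != 0.
Proof. by apply: contra_neq nz_v; exact: pure_one_eq0. Qed.

Lemma irreducible_U1V : irreducible_module slM act U1V.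
Proof.
split; [exact: U1V_submodule | | move=> W subW _].
  by exists (pure_tensor 1 v); [exact: U1V_one | exact: pure_one_neq0].
have [[m [Wm nz]]|none] := pselect (exists m, m \in W /\ m != 0).
  by right; exact: U1V_min Wm nz.
by left=> m Wm; apply/eqP; apply: contrapT => /negP nz; apply: none; exists m.
Qed.

Lemma irreducible_iff :
  irreducible_module slM act predT <-> ~ exists j K, critical j K.
Proof.
split=> [[_ _ irr] [j [K cK]]|none].
  have [m nGm] := critical_not_generated cK.
  have [//|U0|Uall] := irr _ U1V_submodule.
    by have := pure_one_neq0; rewrite (U0 _ (U1V_one v)) eqxx.
  by apply: nGm; apply/mem_U1V; exact: Uall.
have all_gen m : m \in U1V.
  apply/mem_U1V; apply: contrapT => nGm; apply: none.
  have [j [K [_ [cK _ _]]]] := proper_critical generated_stable generated_one nGm.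
  by exists j, K.
have [_ [m _ nz] irr] := irreducible_U1V.
split=> // [|W subW _]; first by exists m.
have [|W0|Wall] := irr W subW; [by move=> x _; exact: all_gen | by left |].
by right=> x _; exact: Wall.
Qed.

Lemma irreducible_quotient j K : critical j K ->
  irreducible_module slM
    (quot_act (N_closed := Uspan_submod_closed slM act (@one_tensor F n V)) act) predT.
Proof.
move=> cK; set cl := Uspan_submod_closed _ _ _.
pose pr : M -> quot_module cl := quot_proj cl.
have actE a m : slM a -> quot_act act a (pr m) = pr (act a m).
  move=> sla; apply: (quot_actE cl m sla); last exact: U1V_submodule.
  by move=> b; exact: vf_act_linear.
have pr0 m : pr m = 0 <-> m \in U1V.
  have pr00 : pr 0 = 0 by apply: (addrI (pr 0)); rewrite -[LHS](quot_projD cl) !addr0.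
  by rewrite -pr00; split=> [/quot_eqP|Um]; [|apply/quot_eqP]; rewrite subr0.
have prD x y : pr (x + y) = pr x + pr y by exact: quot_projD.
have prZ c x : pr (c *: x) = c *: pr x by symmetry; exact: (quot_scaleE cl).
split=> // [|Q [[Q0 QL] aQ] _].
  have [m nGm] := critical_not_generated cK.
  by exists (pr m) => //; apply/eqP => /pr0/mem_U1V.
have stW : sl_stable_subspace (fun m => pr m \in Q).
  apply: (lie_submodule_stable (W := [pred m | pr m \in Q])).
  split; last by move=> a m sla Qm; rewrite inE -actE //; exact: aQ.
  split=> [|c x y Qx Qy]; rewrite inE.
    by have -> : pr 0 = 0; [apply/pr0; exact: cl.1 | exact: Q0].
  by rewrite prD prZ; exact: QL.
have W1 : one_subspace (fun m => pr m \in Q).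
  by move=> u; have -> : pr (pure_tensor 1 u) = 0; [apply/pr0; exact: U1V_one | exact: Q0].
have [[m nQm]|all] := pselect (exists m, ~ pr m \in Q); [left | right] => q.
  rewrite -[q](quot_reprK (N_closed := cl)) => Qq; apply/pr0/mem_U1V.
  exact: (proper_generated stW W1 nQm).
move=> _; rewrite -[q](quot_reprK (N_closed := cl)); apply: contrapT => nQ.
by apply: all; exists (quot_repr q).
Qed.

End TensorFunctionals.

Theorem mainTheorem1 (F : fieldType) (F_char0 : [pchar F] =i pred0)
    (n : nat) (n_ge2 : (1 < n)%N)
    (V : vectType F) (rho : {linear 'M[F]_n -> 'End(V)}) (mu : 'I_n -> F)
    (V_rep : gl_representation rho) (V_irr : gl_irreducible rho)
    (V_mu : highest_weight rho mu) :
  let sl := @sl_span F n in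
  let U1V := Uspan sl (vf_act rho) (@one_tensor F n V) in
  let U1V_closed : submod_closed U1V :=
    Uspan_submod_closed sl (vf_act rho) (@one_tensor F n V) in
  (irreducible_module sl (vf_act rho) predT
     <-> weight_cond_first n_ge2 mu /\ weight_cond_inner mu)
  /\
  (~ weight_cond_first n_ge2 mu \/ ~ weight_cond_inner mu ->
     irreducible_module sl (vf_act rho) U1V
     /\ irreducible_module sl
          (quot_act (N_closed := U1V_closed) (vf_act rho)) predT).
Proof.
move=> sl U1V U1V_closed; have [v [nz_v wt_v sing_v]] := V_mu.
have condE := weight_conditions F_char0 V_rep V_irr nz_v wt_v sing_v n_ge2.
split; first by rewrite (irreducible_iff F_char0 V_rep V_irr nz_v wt_v sing_v) condE.
move=> fails; split; first exact: irreducible_U1V nz_v wt_v sing_v.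
have [[j [K cK]]|none] := pselect (exists j K, critical mu j K).
  exact: (irreducible_quotient F_char0 V_rep V_irr nz_v wt_v sing_v cK).
by have [c1 c2] := condE.2 none; case: fails.
Qed.
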